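(* Let $\mathfrak g$ be a finite-dimensional real quadratic Lie algebra with $\mathrm{ad}$-invariant inner product $B$, and let $\sigma_0:S(\widetilde{T\mathfrak g[1]})\to W_{\mathfrak g}$ be the algebra map of the context. Under $\sigma_0$, the basic complex of $W^K_{\mathfrak g}$ corresponds exactly to the invariant symmetric tensors of $\widetilde{T\mathfrak g[1]}$; that is, $\sigma_0$ gives a one-to-one correspondence $$\sigma_0:\ S(\widetilde{T\mathfrak g[1]})^{inv}\longleftrightarrow (W_{\mathfrak g})_{basic}.$$ Therefore $S(\widetilde{T\mathfrak g[1]})^{inv}\cong S(\mathfrak g)^{\mathfrak g}$.
   Context: Fix an orthonormal basis $e_1,\dots,e_n$ of $\mathfrak g$ for $B$, with $[e_a,e_b]=f_{abc}e_c$ (summation convention; $f_{abc}$ is totally antisymmetric), and identify $\mathfrak g^*$ with $\mathfrak g$ by $B$. The Lie superalgebra $\widetilde{T\mathfrak g[1]}$ has even basis elements $e_1,\dots,e_n,\mathfrak c$ and odd basis elements $\overline{e_1},\dots,\overline{e_n}$, with $\mathfrak c$ central and $[e_a,e_b]=f_{abc}e_c$, $[e_a,\overline{e_b}]=f_{abc}\overline{e_c}$, $[\overline{e_a},\overline{e_b}]=\delta_{ab}\mathfrak c$. $S(\widetilde{T\mathfrak g[1]})$ is its (super)symmetric algebra, on which $\widetilde{T\mathfrak g[1]}$ acts by extending the adjoint action by superderivations; $S(\widetilde{T\mathfrak g[1]})^{inv}$ is the space of elements annihilated by this action. The Weil algebra is $W_{\mathfrak g}=S(\mathfrak g^* )\otimes\wedge(\mathfrak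 g^* )$, with commuting even generators $v^a$ and anticommuting odd generators $\theta^a$ corresponding to the basis dual to $e_a$. It carries derivations $L_a$ (even), $\iota_a$ (odd) and $d$ (odd) given by $$L_av^b=f_{abc}v^c,\quad L_a\theta^b=f_{abc}\theta^c,\quad \iota_av^b=0,\quad \iota_a\theta^b=\delta_{ab},\quad dv^a=-f_{abc}\theta^bv^c,\quad d\theta^a=v^a-\tfrac12f_{abc}\theta^b\theta^c.$$ $W^K_{\mathfrak g}$ is the algebra $S(\mathfrak g^* )\otimes\wedge(\mathfrak g^* )$ with generators $\widehat v^a$ (even) and $\theta^a$ (odd) and derivations $$L_a\widehat v^b=f_{abc}\widehat v^c,\quad L_a\theta^b=f_{abc}\theta^c,\quad \iota_a\widehat v^b=f_{abc}\theta^c,\quad \iota_a\theta^b=\delta_{ab},\quad d\widehat v^a=0,\quad d\theta^a=\widehat v^a.$$ The algebra isomorphism $\tau_0:W^K_{\mathfrak g}\to W_{\mathfrak g}$, $\widehat v^a\mapsto v^a-\frac12f_{abc}\theta^b\theta^c$, $\theta^a\mapsto\theta^a$, commutes with all these operators, and so identifies the basic complexes of the two. The basic complex (in $W_{\mathfrak g}$, written $(W_{\mathfrak g})_{basic}$) consists of the elements annihilated by all $\iota_a$ and all $L_a$, with differential $d$. The map $\sigma_0:S(\widetilde{T\mathfrak g[1]})\to W_{\mathfrak g}$ is the algebra homomorphism obtained by setting $\mathfrak c=1$, identifying $S(\widetilde{T\mathfrak g[1]})/\langle\mathfrak c=1\rangle$ with $W^K_{\mathfrak g}$ by means of $B$ ($e_a\mapsto\widehat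 v^a$, $\overline{e_a}\mapsto\theta^a$), and then applying $\tau_0$. Thus $\sigma_0(e_a)=v^a-\frac12f_{abc}\theta^b\theta^c$, $\sigma_0(\overline{e_a})=\theta^a$, $\sigma_0(\mathfrak c)=1$. $S(\mathfrak g)^{\mathfrak g}$ denotes the $\mathrm{ad}$-invariant elements of the symmetric algebra $S(\mathfrak g)$.
   Formalization: The correspondence and the isomorphism with S(g)^g are stated modulo c = 1 (both for invariants modulo their ideal generated by c−1 and for invariants of the quotient by c=1), since 1 and c are distinct invariants with the same image under σ0. *)

(* Defs.v *)
From HB Require Import structures.
From mathcomp Require Import all_boot all_order all_algebra.
From mathcomp Require Import reals.
From mathcomp Require Import mpoly.

Set Implicit Arguments.
Unset Strict Implicit.
Unset Printing Implicit Defensive.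

Import GRing.Theory Num.Theory.
Local Open Scope ring_scope.

Section ExteriorSign.
Variable n : nat.
Implicit Types S T U : {set 'I_n}.

Definition inversions S T : nat := (\sum_(i in S) \sum_(j in T) (j < i))%N.

Lemma big_disjU S T (F : 'I_n -> nat) : [disjoint S & T] ->
  (\sum_(i in S :|: T) F i = \sum_(i in S) F i + \sum_(i in T) F i)%N.
Proof.
move=> dST; rewrite -bigU //; apply: eq_bigl => i.
by rewrite inE.
Qed.

Lemma inversions0l T : inversions set0 T = 0%N.
Proof. by rewrite /inversions big_set0. Qed.

Lemma inversions0r S : inversions S set0 = 0%N.
Proof. by rewrite /inversions big1 // => i _; rewrite big_set0. Qed.

Lemma inversionsUl S T U : [disjoint S & T] ->
  inversions (S :|: T) U = (inversions S U + inversions T U)%N.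
Proof. exact: big_disjU. Qed.

Lemma inversionsUr S T U : [disjoint T & U] ->
  inversions S (T :|: U) = (inversions S T + inversions S U)%N.
Proof.
move=> dTU; rewrite /inversions -big_split /=.
by apply: eq_bigr => i _; apply: big_disjU.
Qed.

Lemma inversions1 i j : inversions [set i] [set j] = (j < i)%N.
Proof. by rewrite /inversions !big_set1. Qed.

Lemma inversionsC S T : [disjoint S & T] ->
  (inversions S T + inversions T S = #|S| * #|T|)%N.
Proof.
move=> dST; rewrite /inversions [X in (_ + X)%N]exchange_big /= -big_split /=.
rewrite -sum_nat_const; apply: eq_bigr => i iS; rewrite -big_split /=.
rewrite -sum1_card; apply: eq_bigr => j jT; case: ltngtP => // eq_ij.
by move: jT; rewrite (val_inj eq_ij : j = i) (disjointFr dST iS).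
Qed.

(* the scalar e with theta_S * theta_T = e *: theta_(S :|: T), where theta_S
   is the product of the odd generators theta_i, i in S, in increasing order *)
Definition ext_sign (A : pzRingType) S T : A :=
  if [disjoint S & T] then (-1) ^+ inversions S T else 0.

Lemma ext_sign0l (A : pzRingType) T : ext_sign A set0 T = 1.
Proof. by rewrite /ext_sign inversions0l -setI_eq0 set0I eqxx. Qed.

Lemma ext_sign0r (A : pzRingType) S : ext_sign A S set0 = 1.
Proof. by rewrite /ext_sign inversions0r -setI_eq0 setI0 eqxx. Qed.

Lemma ext_signC (A : pzRingType) S T :
  ext_sign A S T = (-1) ^+ (#|S| * #|T|) * ext_sign A T S.
Proof.
rewrite /ext_sign [in RHS]disjoint_sym; case: ifP => [dST|]; last by rewrite mulr0.
by rewrite -inversionsC // exprD -mulrA -exprD addnn -mul2n exprM sqrrN !expr1n mulr1.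
Qed.

Lemma ext_sign_cocycle (A : pzRingType) S T U :
  ext_sign A S T * ext_sign A (S :|: T) U =
  ext_sign A S (T :|: U) * ext_sign A T U.
Proof.
rewrite /ext_sign.
have -> : [disjoint S :|: T & U] = [disjoint S & U] && [disjoint T & U].
  by rewrite -!setI_eq0 setIUl setU_eq0.
have -> : [disjoint S & T :|: U] = [disjoint S & T] && [disjoint S & U].
  by rewrite -!setI_eq0 setIUr setU_eq0.
case: (boolP [disjoint S & T]) => dST; case: (boolP [disjoint S & U]) => dSU;
  case: (boolP [disjoint T & U]) => dTU; rewrite /= ?mul0r ?mulr0 //.
by rewrite inversionsUl // inversionsUr // -!exprD addnA.
Qed.

End ExteriorSign.

(* S(V0 (+) V1) = S(V0) (x) Lambda(V1) for dim V0 = m and dim V1 = n: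
   x S is the (polynomial) coefficient of theta_S *)
Definition superpoly (R : comNzRingType) (m n : nat) : Type :=
  {ffun {set 'I_n} -> {mpoly R[m]}}.

Section SuperpolyRing.
Variables (R : comNzRingType) (m n : nat).
Local Notation SP := (superpoly R m n).
Local Notation P := {mpoly R[m]}.
Local Notation eps := (@ext_sign n P).
Implicit Types (x y z : SP) (S T U : {set 'I_n}) (p q : P).

HB.instance Definition _ := GRing.Lmodule.copy SP {ffun {set 'I_n} -> P}.

Definition sp_mono p S : SP := [ffun U => if U == S then p else 0].

Definition sp_one : SP := sp_mono 1 set0.

Definition sp_mul x y : SP :=
  [ffun U => \sum_S \sum_(T | S :|: T == U) eps S T * (x S * y T)].

Lemma spD x y U : (x + y) U = x U + y U. Proof. by rewrite ffunE. Qed.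

Lemma sp_sum I (r : seq I) (Q : pred I) (F : I -> SP) U :
  (\sum_(i <- r | Q i) F i) U = \sum_(i <- r | Q i) F i U.
Proof.
apply: (big_morph (fun x : SP => x U)) => [x y|]; first exact: spD.
by rewrite ffunE.
Qed.

Lemma sp_monoE x : x = \sum_S sp_mono (x S) S.
Proof.
apply/ffunP=> U; rewrite sp_sum (bigD1 U) //= ffunE eqxx big1 ?addr0 // => S nS.
by rewrite ffunE eq_sym (negbTE nS).
Qed.

Lemma sp_mulDl : left_distributive sp_mul +%R.
Proof.
move=> x y z; apply/ffunP=> U; rewrite !ffunE -big_split; apply: eq_bigr => S _.
by rewrite -big_split; apply: eq_bigr => T _; rewrite spD mulrDl mulrDr.
Qed.

Lemma sp_mulDr : right_distributive sp_mul +%R.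
Proof.
move=> x y z; apply/ffunP=> U; rewrite !ffunE -big_split; apply: eq_bigr => S _.
by rewrite -big_split; apply: eq_bigr => T _; rewrite spD !mulrDr.
Qed.

Lemma sp_mul0l x : sp_mul 0 x = 0.
Proof. by apply: (addIr (sp_mul 0 x)); rewrite -sp_mulDl !add0r. Qed.

Lemma sp_mul0r x : sp_mul x 0 = 0.
Proof. by apply: (addIr (sp_mul x 0)); rewrite -sp_mulDr !add0r. Qed.

Lemma sp_mul_suml I (r : seq I) (F : I -> SP) y :
  sp_mul (\sum_(i <- r) F i) y = \sum_(i <- r) sp_mul (F i) y.
Proof.
apply: (big_morph (sp_mul^~ y)) => [x z|]; [exact: sp_mulDl | exact: sp_mul0l].
Qed.

Lemma sp_mul_sumr I (r : seq I) (F : I -> SP) y :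
  sp_mul y (\sum_(i <- r) F i) = \sum_(i <- r) sp_mul y (F i).
Proof.
apply: (big_morph (sp_mul y)) => [x z|]; [exact: sp_mulDr | exact: sp_mul0r].
Qed.

Lemma sp_mul_mono p q S T :
  sp_mul (sp_mono p S) (sp_mono q T) = sp_mono (eps S T * (p * q)) (S :|: T).
Proof.
apply/ffunP=> U; rewrite !ffunE (bigD1 S) //= [X in _ + X]big1 ?addr0; last first.
  move=> S' nS; apply: big1 => T' _.
  by rewrite ffunE (negbTE nS) mul0r mulr0.
rewrite big_mkcond (bigD1 T) //= [X in _ + X]big1 ?addr0; last first.
  move=> T' nT; case: ifP => // _.
  by rewrite [sp_mono q T T']ffunE (negbTE nT) !mulr0.
by rewrite eq_sym !ffunE !eqxx.
Qed.

Lemma sp_mulA : associative sp_mul.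
Proof.
move=> x y z; rewrite (sp_monoE x) (sp_monoE y) (sp_monoE z).
rewrite !sp_mul_suml; apply: eq_bigr => S _.
rewrite sp_mul_sumr [X in _ = sp_mul X _]sp_mul_sumr sp_mul_suml.
apply: eq_bigr => T _.
rewrite 2!sp_mul_sumr [RHS]sp_mul_sumr; apply: eq_bigr => U _.
rewrite !sp_mul_mono setUA; congr (sp_mono _ _).
rewrite [x S * (_ * _)]mulrCA !mulrA -ext_sign_cocycle.
by rewrite [ext_sign P S T * _]mulrC.
Qed.

Lemma sp_mul1l : left_id sp_one sp_mul.
Proof.
move=> x; rewrite (sp_monoE x) sp_mul_sumr; apply: eq_bigr => S _.
by rewrite sp_mul_mono ext_sign0l !mul1r set0U.
Qed.

Lemma sp_mul1r : right_id sp_one sp_mul.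
Proof.
move=> x; rewrite (sp_monoE x) sp_mul_suml; apply: eq_bigr => S _.
by rewrite sp_mul_mono ext_sign0r mul1r mulr1 setU0.
Qed.

Lemma sp_one_neq0 : sp_one != 0.
Proof.
apply/eqP=> /ffunP/(_ set0); rewrite !ffunE eqxx => /eqP.
by rewrite oner_eq0.
Qed.

HB.instance Definition _ := GRing.Zmodule_isNzRing.Build SP
  sp_mulA sp_mul1l sp_mul1r sp_mulDl sp_mulDr sp_one_neq0.

Lemma sp_scalerAl (a : R) x y : a *: (x * y) = (a *: x) * y.
Proof.
apply/ffunP=> U; rewrite !ffunE scaler_sumr; apply: eq_bigr => S _.
rewrite scaler_sumr; apply: eq_bigr => T _.
by rewrite ffunE scalerAr scalerAl.
Qed.

HB.instance Definition _ := GRing.Lmodule_isLalgebra.Build R SP sp_scalerAl.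

Lemma sp_scalerAr (a : R) x y : a *: (x * y) = x * (a *: y).
Proof.
apply/ffunP=> U; rewrite !ffunE scaler_sumr; apply: eq_bigr => S _.
rewrite scaler_sumr; apply: eq_bigr => T _.
by rewrite ffunE 2!scalerAr.
Qed.

HB.instance Definition _ := GRing.Lalgebra_isAlgebra.Build R SP sp_scalerAr.

End SuperpolyRing.

Section Superderivations.
Variables (R : comNzRingType) (m n : nat).
Local Notation SP := (superpoly R m n).
Local Notation P := {mpoly R[m]}.
Implicit Types (x y z : SP) (S T U : {set 'I_n}) (p q : P).

Definition sp_even (i : 'I_m) : SP := sp_mono 'X_i set0.
Definition sp_odd (j : 'I_n) : SP := sp_mono 1 [set j].

Definition has_parity (b : bool) x := forall U, odd #|U| != b -> x U = 0.

Definition sp_deven (i : 'I_m) x : SP := [ffun U => (x U)^`M(i)].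

(* the left derivative d/dtheta_j *)
Definition sp_dodd (j : 'I_n) x : SP :=
  [ffun U : {set _} => if j \in U then 0
             else (-1) ^+ inversions [set j] U * x (j |: U)].

(* the superderivation sending the generators 'X_i to u i and theta_j to w j *)
Definition sder (u : 'I_m -> SP) (w : 'I_n -> SP) x : SP :=
  \sum_i u i * sp_deven i x + \sum_j w j * sp_dodd j x.

Definition grade x : SP := [ffun U : {set _} => (-1) ^+ odd #|U| * x U].

Lemma sp_mulE x y : x * y = sp_mul x y. Proof. by []. Qed.

Lemma sp_monoM p q S T :
  sp_mono p S * sp_mono q T = sp_mono (ext_sign P S T * (p * q)) (S :|: T).
Proof. exact: sp_mul_mono. Qed.

Lemma sp_monoD p q S : sp_mono (p + q) S = sp_mono p S + sp_mono q S.
Proof. by apply/ffunP=> U; rewrite !ffunE; case: ifP; rewrite ?addr0. Qed.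

Lemma sp_mono0 S : sp_mono 0 S = 0 :> SP.
Proof. by apply/ffunP=> U; rewrite !ffunE; case: ifP. Qed.

Lemma sp_monoZ (a : R) p S : sp_mono (a *: p) S = a *: sp_mono p S.
Proof. by apply/ffunP=> U; rewrite !ffunE; case: ifP; rewrite ?scaler0. Qed.

Lemma superpoly_ind (K : SP -> Prop) :
    K 0 -> (forall x y, K x -> K y -> K (x + y)) ->
    (forall p, K (sp_mono p set0)) -> (forall j x, K x -> K (sp_odd j * x)) ->
  forall x, K x.
Proof.
move=> K0 KD KC KM x; rewrite (sp_monoE x); apply: (big_ind K) => // S _.
move: (x S) => p; elim: {S}_.+1 {-2}S (ltnSn #|S|) p => // k IHk S leSk p.
have [->|[j jS]] := set_0Vmem S; first exact: KC.
have -> : sp_mono p S = sp_odd j * sp_mono (ext_sign P [set j] (S :\ j) * p) (S :\ j).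
  rewrite sp_monoM setD1K // mul1r mulrA /ext_sign.
  have -> : [disjoint [set j] & S :\ j] by rewrite disjoints1 !inE eqxx.
  by rewrite -exprD addnn -mul2n exprM sqrrN !expr1n mul1r.
by apply/KM/IHk; rewrite (cardsD1 j) jS in leSk.
Qed.

Lemma grade_mono p S : grade (sp_mono p S) = sp_mono ((-1) ^+ odd #|S| * p) S.
Proof.
by apply/ffunP=> U; rewrite !ffunE; case: eqP => [->|_] //; rewrite mulr0.
Qed.

Lemma grade_is_linear : linear grade.
Proof.
by move=> a x y; apply/ffunP=> U; rewrite !ffunE mulrDr scalerAr.
Qed.
HB.instance Definition _ := GRing.isLinear.Build R SP SP _ grade grade_is_linear.

Lemma gradeK : involutive grade.
Proof.
move=> x; apply/ffunP=> U; rewrite !ffunE mulrA -exprD addnn -mul2n exprM.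
by rewrite sqrrN !expr1n mul1r.
Qed.

Lemma gradeM x y : grade (x * y) = grade x * grade y.
Proof.
rewrite (sp_monoE x) (sp_monoE y) !raddf_sum !mulr_suml raddf_sum.
apply: eq_bigr => S _; rewrite !mulr_sumr !raddf_sum; apply: eq_bigr => T _.
rewrite /= sp_monoM !grade_mono sp_monoM; congr (sp_mono _ _).
rewrite /ext_sign; case: ifP => [dST|_]; last by rewrite !mul0r mulr0.
have -> : #|S :|: T| = (#|S| + #|T|)%N.
  by rewrite cardsU (eqP (_ : S :&: T == set0)) ?cards0 ?subn0 ?setI_eq0.
rewrite !signr_odd exprD mulrCA; congr (_ * _).
by rewrite mulrACA.
Qed.

Lemma grade_parity (b : bool) x : has_parity b x -> grade x = (-1) ^+ b *: x.
Proof.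
move=> hx; apply/ffunP=> U; rewrite !ffunE.
have [->|/hx ->] := eqVneq (odd #|U|) b; last by rewrite mulr0 scaler0.
by case: (b); rewrite ?expr1 ?expr0 ?scale1r ?mul1r // scaleN1r mulN1r.
Qed.

Lemma parity_comm (b : bool) u x :
  has_parity b u -> u * x = iter b grade x * u.
Proof.
move=> hu; rewrite (sp_monoE u) (sp_monoE x) !mulr_suml mulr_sumr.
apply: eq_bigr => S _; have [oS|/hu ->] := eqVneq (odd #|S|) b; last first.
  by rewrite sp_mono0 mul0r mulr0.
have iter_sum : iter b grade (\sum_(T : {set 'I_n}) sp_mono (x T) T) =
    \sum_(T : {set 'I_n}) sp_mono ((-1) ^+ (odd #|T| && b) * x T) T :> SP.
  case: (b) => /=; first by rewrite raddf_sum; apply: eq_bigr => T _; rewrite /= grade_mono andbT.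
  by apply: eq_bigr => T _; rewrite andbF mul1r.
rewrite iter_sum mulr_sumr mulr_suml; apply: eq_bigr => T _.
rewrite !sp_monoM setUC; congr (sp_mono _ _).
rewrite -oS andbC -oddM signr_odd [in LHS]ext_signC.
by rewrite -[LHS]mulrA [LHS]mulrCA -[in RHS]mulrA [x T * u S]mulrC.
Qed.

Lemma sp_deven_is_linear i : linear (sp_deven i).
Proof. by move=> a x y; apply/ffunP=> U; rewrite !ffunE linearP. Qed.
HB.instance Definition _ i :=
  GRing.isLinear.Build R SP SP _ (sp_deven i) (sp_deven_is_linear i).

Lemma sp_dodd_is_linear j : linear (sp_dodd j).
Proof.
move=> a x y; apply/ffunP=> U; rewrite !ffunE; case: ifP => _.
  by rewrite scaler0 addr0.
by rewrite mulrDr scalerAr.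
Qed.
HB.instance Definition _ j :=
  GRing.isLinear.Build R SP SP _ (sp_dodd j) (sp_dodd_is_linear j).

Lemma sder_is_linear u w : linear (sder u w).
Proof.
move=> a x y; rewrite /sder scalerDr !scaler_sumr addrACA -!big_split /=.
by congr (_ + _); apply: eq_bigr => i _; rewrite linearP mulrDr scalerAr.
Qed.
HB.instance Definition _ u w :=
  GRing.isLinear.Build R SP SP _ (sder u w) (sder_is_linear u w).

Lemma sp_devenM i x y :
  sp_deven i (x * y) = sp_deven i x * y + x * sp_deven i y.
Proof.
apply/ffunP=> U; rewrite !ffunE -big_split raddf_sum; apply: eq_bigr => S _ /=.
rewrite -big_split raddf_sum; apply: eq_bigr => T _ /=.
rewrite !ffunE /ext_sign -mulrDr -mderivM; case: ifP => _; last first.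
  by rewrite !mul0r linear0.
by rewrite -signr_odd; case: (odd _); rewrite ?mulN1r ?mul1r ?linearN.
Qed.

Lemma sp_doddE j x U : sp_dodd j x U =
  if j \in U then 0 else (-1) ^+ inversions [set j] U * x (j |: U).
Proof. by rewrite ffunE. Qed.

Lemma spN x U : (- x) U = - x U. Proof. by rewrite ffunE. Qed.

Lemma spZ (a : R) x U : (a *: x) U = a *: x U. Proof. by rewrite ffunE. Qed.

Lemma sp_oddME j x U : (sp_odd j * x) U =
  if j \in U then (-1) ^+ inversions [set j] (U :\ j) * x (U :\ j) else 0.
Proof.
rewrite [X in _ * X](sp_monoE x) mulr_sumr sp_sum.
under eq_bigr do rewrite sp_monoM ffunE mul1r /ext_sign disjoints1.
case: ifP => jU.
  rewrite (bigD1 (U :\ j)) //= setD1K // eqxx !inE eqxx /= big1 ?addr0 // => S nS.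
  case: (boolP (j \in S)) => /= jS; first by rewrite mul0r; case: ifP.
  by case: eqP => // eU; rewrite eU setU1K ?eqxx // in nS.
by rewrite big1 // => S _; case: eqP => // eU; rewrite eU setU11 in jU.
Qed.

Lemma sp_dodd_oddM j k x :
  sp_dodd j (sp_odd k * x) = (j == k)%:R *: x - sp_odd k * sp_dodd j x.
Proof.
apply/ffunP=> U; rewrite spD spN spZ sp_doddE !sp_oddME !sp_doddE.
have [<-{k}|nkj] := eqVneq j k.
  rewrite scale1r setU11; case: ifP => jU.
    by rewrite !inE eqxx /= setD1K // mulrA -exprD addnn -mul2n exprM sqrrN
      !expr1n mul1r subrr.
  rewrite setU1K ?jU // mulrA -exprD addnn -mul2n exprM sqrrN !expr1n mul1r.
  by rewrite subr0.
rewrite scale0r add0r !inE [k == j]eq_sym (negbTE nkj) /=.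
case: (boolP (k \in U)) => kU; last by rewrite oppr0 mulr0; case: ifP.
case: ifP => jU; first by rewrite mulr0 oppr0.
have -> : (j |: U) :\ k = j |: U :\ k.
  apply/setP=> i; rewrite !inE; case: (eqVneq i k) => //= ->.
  by rewrite eq_sym (negbTE nkj).
have dj : [disjoint [set j] & U :\ k] by rewrite disjoints1 !inE jU andbF.
have dk : [disjoint [set k] & U :\ k] by rewrite disjoints1 !inE eqxx.
rewrite -{1}(setD1K kU) !inversionsUr // !inversions1 !mulrA -mulNr -!exprD.
congr (_ * _); rewrite -[RHS]mulN1r -exprS.
rewrite -[LHS]signr_odd -[RHS]signr_odd; congr (_ ^+ (nat_of_bool _)).
rewrite /= !oddD; case: ltngtP nkj => [||/val_inj->]; rewrite ?eqxx //= => _ _.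
all: by case: (odd _); case: (odd _).
Qed.

Lemma sp_doddC j p : sp_dodd j (sp_mono p set0) = 0.
Proof.
apply/ffunP=> U; rewrite !ffunE; case: ifP => // _; case: eqP => [e|]; last by rewrite mulr0.
by have := setU11 j U; rewrite e inE.
Qed.

Lemma grade_odd j : grade (sp_odd j) = - sp_odd j.
Proof.
rewrite grade_mono cards1 /= expr1 mulN1r -[LHS]addr0 -(subrr (sp_odd j)) addrA.
by rewrite -sp_monoD addNr sp_mono0 add0r.
Qed.

Lemma sp_doddM j x y :
  sp_dodd j (x * y) = sp_dodd j x * y + grade x * sp_dodd j y.
Proof.
elim/superpoly_ind: x y => [|x z IHx IHz|p|k x IHx] y.
- by rewrite raddf0 !mul0r !raddf0 mul0r addr0.
- by rewrite mulrDl !raddfD /= IHx IHz !mulrDl addrACA.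
- rewrite sp_doddC mul0r add0r grade_mono cards0 mul1r.
  apply/ffunP=> U; rewrite ffunE.
  have CE z V : (sp_mono p set0 * z) V = p * z V.
    rewrite [X in _ * X](sp_monoE z) mulr_sumr sp_sum (bigD1 V) //= big1 ?addr0.
      by rewrite sp_monoM ext_sign0l mul1r set0U ffunE eqxx.
    by move=> S nS; rewrite sp_monoM set0U ffunE eq_sym (negbTE nS).
  by rewrite !CE ffunE; case: ifP => _; rewrite ?mulr0 // mulrCA.
- rewrite -mulrA !sp_dodd_oddM IHx gradeM grade_odd mulrBl scalerAl mulrDr.
  by rewrite opprD addrA !mulrA !mulNr.
Qed.

(* sder u w is the superderivation of parity b with the prescribed values *)
Lemma sderM (b : bool) u w :
    (forall i, has_parity b (u i)) -> (forall j, has_parity (~~ b) (w j)) ->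
  forall x y, sder u w (x * y) = sder u w x * y + iter b grade x * sder u w y.
Proof.
move=> hu hw x y; rewrite /sder mulrDl mulrDr !mulr_suml !mulr_sumr addrACA.
rewrite -!big_split /=; congr (_ + _); apply: eq_bigr => i _.
  by rewrite sp_devenM mulrDr !mulrA -(parity_comm x (hu i)).
rewrite sp_doddM mulrDr !mulrA (parity_comm (grade x) (hw i)).
by case: (b); last rewrite /= gradeK.
Qed.

Lemma sder_even u w i : sder u w (sp_even i) = u i.
Proof.
rewrite /sder [X in _ + X]big1 ?addr0; last first.
  by move=> j _; rewrite sp_doddC mulr0.
have dX k : sp_deven k (sp_even i) = (k == i)%:R.
  apply/ffunP=> U; rewrite ffunE [sp_even i U]ffunE.
  have -> : (k == i)%:R = (k == i)%:R *: sp_mono 1 set0 :> SP.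
    by case: eqP => _; rewrite ?scale1r ?scale0r.
  rewrite !ffunE; case: eqP => _; last by rewrite linear0 scaler0.
  rewrite mderivX mnm1E; have [->|nk] := eqVneq k i; last first.
    by rewrite !scale0r.
  suff -> : (U_(i) - U_(i) = 0 :> 'X_{1..m})%MM by rewrite mpolyX0.
  by apply/mnmP=> l; rewrite mnmBE subnn mnm0E.
rewrite (bigD1 i) //= dX eqxx mulr1 big1 ?addr0 // => k /negbTE nk.
by rewrite dX nk mulr0.
Qed.

Lemma sder_odd u w j : sder u w (sp_odd j) = w j.
Proof.
rewrite /sder big1 ?add0r; last first.
  move=> i _; suff -> : sp_deven i (sp_odd j) = 0 by rewrite mulr0.
  apply/ffunP=> U; rewrite !ffunE; case: ifP => _; last exact: linear0.
  by rewrite -[1]mpolyC1 mderivC.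
have dT k : sp_dodd k (sp_odd j) = (k == j)%:R.
  have dC := sp_doddC k 1; have := sp_dodd_oddM k j 1.
  by rewrite mulr1 dC mulr0 subr0 scaler_nat.
rewrite (bigD1 j) //= dT eqxx mulr1 big1 ?addr0 // => k /negbTE nk.
by rewrite dT nk mulr0.
Qed.

End Superderivations.

Section SuperpolyLift.
Variables (R : comNzRingType) (m n : nat) (A : algType R).
Variables (h : 'I_m -> A) (k : 'I_n -> A).
Local Notation SP := (superpoly R m n).

(* the algebra map sending the generators 'X_i to h i and theta_j to k j *)
Definition sp_lift (x : SP) : A :=
  \sum_(S : {set 'I_n}) mmap (in_alg A) h (x S) * \prod_(j in S) k j.

Lemma sp_lift_is_linear : linear sp_lift.
Proof.
move=> a x y; rewrite /sp_lift scaler_sumr -big_split; apply: eq_bigr => S _ /=.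
by rewrite spD spZ mmapD mmapZ mulrDl -mulr_algl mulrA.
Qed.
HB.instance Definition _ := GRing.isLinear.Build R SP A _ sp_lift sp_lift_is_linear.

Lemma sp_lift_mono p S :
  sp_lift (sp_mono p S) = mmap (in_alg A) h p * \prod_(j in S) k j.
Proof.
rewrite /sp_lift (bigD1 S) //= ffunE eqxx [X in _ + X]big1 ?addr0 // => T nT.
by rewrite ffunE (negbTE nT) mmap0 mul0r.
Qed.

Lemma sp_lift_even i : sp_lift (sp_even _ _ i) = h i.
Proof. by rewrite sp_lift_mono big_set0 mulr1 mmapX mmap1U. Qed.

Lemma sp_lift1 : sp_lift 1 = 1.
Proof. by rewrite sp_lift_mono big_set0 mulr1 -mpolyC1 mmapC /= scale1r. Qed.

Lemma sp_lift_odd j : sp_lift (sp_odd _ _ j) = k j.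
Proof. by rewrite sp_lift_mono big_set1 -mpolyC1 mmapC /= scale1r mul1r. Qed.

Hypothesis h_central : forall i a, GRing.comm a (h i).
Hypothesis k_anti : forall i j, k i * k j = - (k j * k i).
Hypothesis k_sq : forall i, k i * k i = 0.

Lemma mul_prod_odd i (T : {set 'I_n}) :
  k i * \prod_(j in T) k j = ext_sign A [set i] T * \prod_(j in i |: T) k j.
Proof.
rewrite !(big_mkcond (fun j => j \in _)) /=.
rewrite /ext_sign disjoints1 /inversions big_set1 [X in (-1) ^+ X]big_mkcond.
rewrite /index_enum -!enumT.
have : sorted ltn (map val (enum 'I_n)) by rewrite val_enum_ord iota_ltn_sorted.
have : i \in enum 'I_n by rewrite mem_enum.
move: (enum _) => s0 /splitPr[s1 s2] srt.
rewrite map_cat /= sorted_pairwise in srt; last exact: ltn_trans.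
move: srt; rewrite pairwise_cat /= => /and3P[/allrelP lt1 _ /andP[/allP lt2 _]].
have {}lt1 j : j \in s1 -> (j < i)%N.
  by move=> js; apply: lt1; rewrite ?map_f ?mem_head.
have {}lt2 j : j \in s2 -> (i < j)%N.
  by move=> js; apply: lt2; rewrite map_f.
rewrite !big_cat !big_cons /= setU11 ltnn if_same add0n.
have -> : (\sum_(j <- s2) (if j \in T then (j < i)%N : nat else 0) = 0)%N.
  rewrite big_seq big1 // => j /lt2 lij; case: ifP => // _.
  by rewrite ltnNge ltnW.
rewrite addn0.
have eqU s : i \notin s -> \prod_(j <- s) (if j \in i |: T then k j else 1) =
    \prod_(j <- s) (if j \in T then k j else 1).
  move=> nis; rewrite big_seq [RHS]big_seq; apply: eq_bigr => j js.
  rewrite !inE; case: eqP => [eji|] //; by rewrite -eji js in nis.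
rewrite (eqU s2); last by apply/negP => /lt2; rewrite ltnn.
have -> : \prod_(j <- s1) (if j \in i |: T then k j else 1) =
    \prod_(j <- s1) (if j \in T then k j else 1).
  by apply: eqU; apply/negP => /lt1; rewrite ltnn.
have comm1 : k i * \prod_(j <- s1) (if j \in T then k j else 1) =
    (-1) ^+ (\sum_(j <- s1) (if j \in T then (j < i)%N : nat else 0)) *
    (\prod_(j <- s1) (if j \in T then k j else 1) * k i).
  elim: s1 {eqU} lt1 => [|j s1 IHs] lt1; first by rewrite !big_nil expr0 !mul1r mulr1.
  have {}IHs := IHs (fun j' js => lt1 j' (mem_behead (s := j :: s1) js)).
  rewrite !big_cons lt1 ?mem_head //; case: ifP => _; last by rewrite !mul1r.
  rewrite mulrA k_anti mulNr -[k j * k i * _]mulrA IHs exprS mulN1r mulNr; congr (- _).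
  by rewrite [LHS]mulrA (commr_sign (k j)) !mulrA.
rewrite mulrA comm1; case: (i \in T) => /=; last by rewrite mul1r -!mulrA.
by rewrite mul0r -!mulrA (mulrA (k i) (k i)) k_sq mul0r !mulr0.
Qed.

Lemma mmap_central (p : {mpoly R[m]}) a : GRing.comm a (mmap (in_alg A) h p).
Proof.
apply: commr_sum => c _; apply: commrM.
  by rewrite /GRing.comm /= mulr_algl mulr_algr.
by rewrite /mmap1; apply: commr_prod => i _; apply/commrX/h_central.
Qed.

Lemma mmapM_central : {morph mmap (in_alg A) h : p q / p * q}.
Proof.
have comm_f (p : {mpoly R[m]}) c c' : GRing.comm (in_alg A p@_c) (mmap1 h c').
  by rewrite /GRing.comm /= mulr_algl mulr_algr.
by case: (commr_mmap_is_multiplicative h_central comm_f).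
Qed.

Lemma sp_liftM : {morph sp_lift : x y / x * y}.
Proof.
move=> x y; elim/superpoly_ind: x y => [|x z IHx IHz|p|j x IHx] y.
- by rewrite !(raddf0, mul0r).
- by rewrite mulrDl !raddfD /= IHx IHz mulrDl.
- rewrite sp_lift_mono big_set0 mulr1 [in LHS](sp_monoE y) mulr_sumr raddf_sum.
  rewrite [in RHS]/sp_lift mulr_sumr; apply: eq_bigr => S _ /=.
  by rewrite sp_monoM sp_lift_mono ext_sign0l mul1r set0U mmapM_central mulrA.
have liftM z : sp_lift (sp_odd _ _ j * z) = k j * sp_lift z.
  rewrite [in LHS](sp_monoE z) mulr_sumr raddf_sum.
  rewrite [in RHS]/sp_lift mulr_sumr; apply: eq_bigr => S _ /=.
  rewrite sp_monoM sp_lift_mono mul1r mmapM_central.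
  rewrite [RHS]mulrA [in RHS]mmap_central -[RHS]mulrA mul_prod_odd [RHS]mulrA.
  congr (_ * _); rewrite [LHS]mmap_central.
  congr (_ * _); rewrite /ext_sign; case: ifP => _; last exact: mmap0.
  rewrite -signr_odd -[in RHS]signr_odd.
  by case: odd; rewrite ?mmapN -mpolyC1 mmapC /= scale1r.
by rewrite -mulrA !liftM IHx mulrA.
Qed.

End SuperpolyLift.

Section SuperpolyLiftSuper.
Variables (R : comNzRingType) (m n m' : nat).
Variable h : 'I_m -> superpoly R m' n.
Hypothesis h_even : forall i, has_parity false (h i).
Local Notation lift_h := (sp_lift h (@sp_odd R m' n)).

Lemma sp_odd_anti (i j : 'I_n) :
  sp_odd R m' i * sp_odd R m' j = - (sp_odd R m' j * sp_odd R m' i).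
Proof.
have oddP : has_parity true (sp_odd R m' i).
  by move=> U; rewrite ffunE; case: (U =P _) => [->|//]; rewrite cards1.
by rewrite (parity_comm _ oddP) /= grade_odd mulNr.
Qed.

Lemma sp_odd_sq (i : 'I_n) : sp_odd R m' i * sp_odd R m' i = 0.
Proof. by rewrite sp_monoM /ext_sign disjoints1 set11 mul0r sp_mono0. Qed.

Lemma sp_lift_monoid_morphism : monoid_morphism lift_h.
Proof.
split; [exact: sp_lift1 | apply: sp_liftM => [i a|i j|i]].
- by rewrite /GRing.comm (parity_comm a (h_even i)).
- exact: sp_odd_anti.
- exact: sp_odd_sq.
Qed.

End SuperpolyLiftSuper.

Record quadratic_lie (R : realType) (g : vectType R) := QuadraticLie {
  lie : g -> g -> g;
  form : g -> g -> R;
  lie_linearl : forall y, linear (lie^~ y);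
  lie_linearr : forall x, linear (lie x);
  lie_alt : forall x, lie x x = 0;
  lie_jacobi : forall x y z,
    lie x (lie y z) + lie y (lie z x) + lie z (lie x y) = 0;
  form_linearl : forall y, scalar (form^~ y);
  form_sym : forall x y, form x y = form y x;
  form_pos : forall x, x != 0 -> 0 < form x x;
  form_ad : forall x y z, form (lie x y) z = form x (lie y z)
}.

Section StructureConstants.
Variables (R : realType) (g : vectType R) (G : quadratic_lie g).
Variables (n : nat) (e : n.-tuple g).

Definition orthonormal_basis : Prop :=
  basis_of fullv e /\
  forall a b : 'I_n, form G (tnth e a) (tnth e b) = (a == b)%:R.

(* [e_a, e_b] = \sum_c f a b c *: e_c *)
Definition structure_const (a b c : 'I_n) : R :=
  form G (lie G (tnth e a) (tnth e b)) (tnth e c).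

End StructureConstants.

Section WeilAlgebras.
Variables (R : realType) (n : nat) (f : 'I_n -> 'I_n -> 'I_n -> R).

Definition weil : Type := superpoly R n n.
HB.instance Definition _ := GRing.Algebra.copy weil (superpoly R n n).

Definition weil_v (a : 'I_n) : weil := sp_even R n a.
Definition weil_th (a : 'I_n) : weil := sp_odd R n a.
Local Notation v := weil_v.
Local Notation th := weil_th.

Definition half_fthth (a : 'I_n) : weil :=
  2^-1 *: \sum_b \sum_c f a b c *: (th b * th c).

Definition W_L (a : 'I_n) : weil -> weil :=
  sder (fun b => \sum_c f a b c *: v c) (fun b => \sum_c f a b c *: th c).
Definition W_iota (a : 'I_n) : weil -> weil :=
  sder (fun=> 0) (fun b => (a == b)%:R).
Definition W_d : weil -> weil :=
  sder (fun a => - \sum_b \sum_c f a b c *: (th b * v c))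
       (fun a => v a - half_fthth a).
Definition W_basic (w : weil) : Prop :=
  forall a, W_iota a w = 0 /\ W_L a w = 0.

(* W^K has the same underlying algebra as W; weil_v a is its generator v^a
   with a hat *)
Definition WK_L : 'I_n -> weil -> weil := W_L.
Definition WK_iota (a : 'I_n) : weil -> weil :=
  sder (fun b => \sum_c f a b c *: th c) (fun b => (a == b)%:R).
Definition WK_d : weil -> weil := sder (fun=> 0) v.
Definition WK_basic (w : weil) : Prop :=
  forall a, WK_iota a w = 0 /\ WK_L a w = 0.

Definition tau0 : weil -> weil := sp_lift (fun a => v a - half_fthth a) th.

End WeilAlgebras.

(* the homogeneous basis e_a, c, e_a-bar of the Lie superalgebra *)
Inductive Tg_basis (n : nat) : Type :=
  | TgE of 'I_n
  | TgC
  | TgO of 'I_n.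
Arguments TgC {n}.

Section SymmetricSuperalgebra.
Variables (R : realType) (n : nat) (f : 'I_n -> 'I_n -> 'I_n -> R).

(* the even generator of index 0 is the central element, and the one of index
   lift ord0 a is e_a *)
Definition STg : Type := superpoly R n.+1 n.
HB.instance Definition _ := GRing.Algebra.copy STg (superpoly R n.+1 n).

Definition STg_c : STg := sp_even R n ord0.

Definition STg_gen (b : Tg_basis n) : STg :=
  match b with
  | TgE a => sp_even R n (lift ord0 a)
  | TgC => STg_c
  | TgO a => sp_odd R n.+1 a
  end.

Definition even_basis (i : 'I_n.+1) : Tg_basis n :=
  if unlift ord0 i is Some a then TgE a else TgC.

(* [e_a-bar, e_b] = - [e_b, e_a-bar] = f_abc e_c-bar *)
Definition Tg_bracket (b b' : Tg_basis n) : STg :=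
  match b, b' with
  | TgE a, TgE a' => \sum_c f a a' c *: STg_gen (TgE c)
  | TgE a, TgO a' => \sum_c f a a' c *: STg_gen (TgO c)
  | TgO a, TgE a' => \sum_c f a a' c *: STg_gen (TgO c)
  | TgO a, TgO a' => (a == a')%:R *: STg_c
  | TgC, _ | _, TgC => 0
  end.

Definition Tg_ad_basis (b : Tg_basis n) : STg -> STg :=
  sder (fun i => Tg_bracket b (even_basis i)) (fun a => Tg_bracket b (TgO a)).

(* the action of the element with coordinates x in the basis Tg_basis n *)
Definition Tg_ad (x : Tg_basis n -> R) (p : STg) : STg :=
  \sum_a x (TgE a) *: Tg_ad_basis (TgE a) p + x TgC *: Tg_ad_basis TgC p +
  \sum_a x (TgO a) *: Tg_ad_basis (TgO a) p.

Definition STg_inv (p : STg) : Prop := forall x, Tg_ad x p = 0.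

(* p and q agree in the quotient of STg by the ideal <c = 1> *)
Definition c1_cong (p q : STg) : Prop := exists z, p - q = (STg_c - 1) * z.

(* the same for the ideal generated by c - 1 in the algebra of invariants: c and
   1 are distinct invariants with the same image under sigma0, so that sigma0
   can be injective only modulo this congruence *)
Definition inv_c1_cong (p q : STg) : Prop :=
  exists2 z, STg_inv z & p - q = (STg_c - 1) * z.

(* the class of p in STg / <c = 1> is invariant *)
Definition STg_c1_inv (p : STg) : Prop := forall x, c1_cong (Tg_ad x p) 0.

Definition set_c1 : STg -> weil R n :=
  sp_lift (fun i => if unlift ord0 i is Some a then weil_v R a else 1)
          (@weil_th R n).

Definition sigma0 (p : STg) : weil R n := tau0 f (set_c1 p).

(* {mpoly R[n]} is S(g), with 'X_a standing for e_a *)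
Definition Sg_ad_basis (a : 'I_n) (p : {mpoly R[n]}) : {mpoly R[n]} :=
  \sum_b (\sum_c f a b c *: 'X_c) * p^`M(b).
Definition Sg_ad (x : 'I_n -> R) (p : {mpoly R[n]}) : {mpoly R[n]} :=
  \sum_a x a *: Sg_ad_basis a p.
Definition Sg_inv (p : {mpoly R[n]}) : Prop := forall x, Sg_ad x p = 0.

End SymmetricSuperalgebra.

(* phi restricts to an isomorphism of algebras P / J -> Q, where P and Q are
   subalgebras of A and B, and J is the congruence on P of an ideal *)
Definition iso_mod (R : realType) (A B : algType R) (phi : A -> B)
    (P : A -> Prop) (J : A -> A -> Prop) (Q : B -> Prop) : Prop :=
  [/\ phi 1 = 1 /\ (forall x y, P x -> P y -> phi (x * y) = phi x * phi y),
      forall (k : R) x y, P x -> P y -> phi (k *: x + y) = k *: phi x + phi y,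
      forall x, P x -> Q (phi x),
      forall w, Q w -> exists2 x, P x & phi x = w &
      forall x y, P x -> P y -> (phi x = phi y <-> J x y)].

Section MapsAreMorphisms.
Variables (R : realType) (n : nat) (f : 'I_n -> 'I_n -> 'I_n -> R).

Lemma parity_lin (m : nat) b I (r : seq I) (F : I -> superpoly R m n) :
  (forall i, has_parity b (F i)) -> has_parity b (\sum_(i <- r) F i).
Proof. by move=> hF U nU; rewrite sp_sum big1 // => i _; apply: hF. Qed.

Lemma parityZ (m : nat) b (k : R) (x : superpoly R m n) :
  has_parity b x -> has_parity b (k *: x).
Proof. by move=> hx U nU; rewrite spZ hx // scaler0. Qed.

Lemma sp_even_parity (m : nat) i : has_parity false (@sp_even R m n i).
Proof. by move=> U; rewrite ffunE; case: (U =P _) => [->|//]; rewrite cards0. Qed.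

Lemma half_fthth_parity a : has_parity false (half_fthth f a).
Proof.
apply/parityZ/parity_lin => b; apply: parity_lin => c; apply: parityZ.
rewrite /weil_th /sp_odd sp_monoM => U nU; rewrite ffunE; case: (U =P _) => // eU.
move: nU; rewrite eU cardsU1 cards1 inE /ext_sign disjoints1 inE.
by case: (b == c); rewrite ?mul0r.
Qed.

Lemma tau0_monoid_morphism : monoid_morphism (tau0 f).
Proof.
apply: sp_lift_monoid_morphism => a U nU.
by rewrite spD spN sp_even_parity // half_fthth_parity // subr0.
Qed.
HB.instance Definition _ :=
  GRing.isLinear.Build R (weil R n) (weil R n) _ (tau0 f)
    (@sp_lift_is_linear R n n (weil R n) _ _).
HB.instance Definition _ :=
  GRing.isMonoidMorphism.Build (weil R n) (weil R n) (tau0 f) tau0_monoid_morphism.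

Lemma set_c1_monoid_morphism : monoid_morphism (@set_c1 R n).
Proof.
apply: sp_lift_monoid_morphism => i U nU.
case: unlift => [a|]; first exact: sp_even_parity.
by rewrite ffunE; case: (U =P _) => // eU; rewrite eU cards0 in nU.
Qed.
HB.instance Definition _ :=
  GRing.isLinear.Build R (STg R n) (weil R n) _ (@set_c1 R n)
    (@sp_lift_is_linear R n.+1 n (weil R n) _ _).
HB.instance Definition _ :=
  GRing.isMonoidMorphism.Build (STg R n) (weil R n) (@set_c1 R n)
    set_c1_monoid_morphism.

HB.instance Definition _ := GRing.LRMorphism.copy (sigma0 f)
  (tau0 f \o @set_c1 R n).

Lemma sigma0_E a :
  sigma0 f (STg_gen R (TgE a)) = weil_v R a - half_fthth f a.
Proof. by rewrite /sigma0 /set_c1 sp_lift_even liftK /tau0 sp_lift_even. Qed.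

Lemma sigma0_O a : sigma0 f (STg_gen R (TgO a)) = weil_th R a.
Proof. by rewrite /sigma0 /set_c1 sp_lift_odd /tau0 sp_lift_odd. Qed.

Lemma sigma0_C : sigma0 f (STg_gen R TgC) = 1.
Proof. by rewrite /sigma0 /set_c1 sp_lift_even unlift_none rmorph1. Qed.

Lemma Tg_ad_gen b b' :
  Tg_ad_basis f b (STg_gen R b') = Tg_bracket f b b'.
Proof.
case: b' => [a||a]; last exact: sder_odd.
- by rewrite /Tg_ad_basis sder_even /even_basis liftK.
- by rewrite /Tg_ad_basis sder_even /even_basis unlift_none.
Qed.

End MapsAreMorphisms.

(* Main.v *)
Require Import Defs.
From HB Require Import structures.
From mathcomp Require Import all_boot all_order all_algebra.
From mathcomp Require Import reals.
From mathcomp Require Import mpoly.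

Set Implicit Arguments.
Unset Strict Implicit.
Unset Printing Implicit Defensive.

Import GRing.Theory Num.Theory.
Local Open Scope ring_scope.

(** Write e_a, c and \bar e_a for the generators of S(Tg[1]~).  The point is that
    the weight-two elements
      u_a = c e_a + 1/2 f_abc \bar e_b \bar e_c
    rotate under ad(e_b) exactly as the e_a do, are killed by every ad(\bar e_b),
    and are sent by sigma0 to v^a.  So p(u) is invariant as soon as p is an
    invariant polynomial, and sigma0 maps it to p(v).

    This is packaged as an algebra map, horizontal_lift : W -> S(Tg[1]~), with
    v^a |-> u_a and theta^a |-> \bar e_a.  It is a right inverse of sigma0, commutes
    with the even operators, and satisfies
      ad(\bar e_a) o horizontal_lift = c . (horizontal_lift o iota_a),
    hence it maps basic elements to invariants.  In the other direction sigma0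
    carries ad(e_a) to L_a and ad(\bar e_a) to iota_a, hence it maps invariants to
    basic elements.  This gives surjectivity.

    For injectivity, tau0 is injective and the kernel of the specialisation c = 1
    is generated by c - 1.  As c - 1 is a central non-zero-divisor killed by the
    action, z is invariant whenever (c - 1) z is, so on invariants the kernel is
    also generated by c - 1 inside the algebra of invariants.

    In W the operators iota_a are the partial derivatives in theta^a, so the basic
    elements are the polynomials in v alone that the L_a kill: this is S(g)^g, and
    the last isomorphism follows.  On a polynomial in v the differential of W equals
    theta^b L_b, so it vanishes on basic elements; in W^K the basic elements are
    stable under d because d d = 0 and d iota_a + iota_a d = L_a.

    All identities between derivations and algebra maps used here
    (superder_intertwine, superder_anticommutator, lrmorphism_gen_ext) hold as soon
    as they hold on generators, by superpoly_gen_ind.  On generators, the only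
    computations that are not immediate are the two on 1/2 f_abc theta^b theta^c in
    superder_quad_th_ad and superder_quad_th_contract; the first is the Jacobi
    identity, the second the total antisymmetry of f. *)

(** * Superpolynomials and their generators *)

Section Generators.
Variables (R : comNzRingType) (m n : nat).
Local Notation SP := (superpoly R m n).
Local Notation P := {mpoly R[m]}.
Implicit Types (x y : SP) (p q : P) (U : {set 'I_n}).

Lemma sp_mono0M p x U : (sp_mono p set0 * x) U = p * x U.
Proof.
rewrite [X in _ * X](sp_monoE x) mulr_sumr sp_sum (bigD1 U) //= big1 ?addr0.
  by rewrite sp_monoM ext_sign0l mul1r set0U ffunE eqxx.
by move=> S nS; rewrite sp_monoM set0U ffunE eq_sym (negbTE nS).
Qed.

Lemma sp_mono0_mul p q : sp_mono (p * q) set0 = sp_mono p set0 * sp_mono q set0 :> SP.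
Proof. by rewrite sp_monoM ext_sign0l mul1r setU0. Qed.

(** Sharper than [superpoly_ind]: monomials in the even generators are also
    peeled off one generator at a time, which makes every identity between
    superderivations and algebra maps a check on generators. *)
Lemma superpoly_gen_ind (K : SP -> Prop) :
    K 1 -> (forall (a : R) x y, K x -> K y -> K (a *: x + y)) ->
    (forall i x, K x -> K (sp_even R n i * x)) ->
    (forall j x, K x -> K (sp_odd R m j * x)) ->
  forall x, K x.
Proof.
move=> K1 KL KE KO.
have K0 : K 0 by rewrite -(subrr (1 : SP)) addrC -scaleN1r; apply: KL.
pose Q q := forall x, K x -> K (sp_mono q set0 * x).
have Q1 : Q 1 by move=> x Kx; rewrite mul1r.
have QM q1 q2 : Q q1 -> Q q2 -> Q (q1 * q2).
  by move=> h1 h2 x Kx; rewrite sp_mono0_mul -mulrA; apply/h1/h2.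
have QX c : Q 'X_[c].
  rewrite mpolyXE_id; apply: (big_ind Q) => // i _.
  by elim: (c i) => // k IHk; rewrite exprS; apply: QM => // x; apply: KE.
apply: superpoly_ind => // [x y Kx Ky|p]; first by rewrite -[x]scale1r; apply: KL.
elim/mpolyind: p => [|a c p _ _ Kp]; first by rewrite sp_mono0.
rewrite sp_monoD sp_monoZ; apply: KL => //.
by rewrite -[sp_mono _ _]mulr1; apply: QX.
Qed.

Lemma parity_odd (j : 'I_n) : has_parity true (sp_odd R m j).
Proof. by move=> U; rewrite ffunE; case: (U =P _) => [->|//]; rewrite cards1. Qed.

Lemma parity_sp_even (i : 'I_m) : has_parity false (sp_even R n i).
Proof. by move=> U; rewrite ffunE; case: (U =P _) => [->|//]; rewrite cards0. Qed.

Lemma parity0 b : @has_parity R m n b 0.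
Proof. by move=> U _; rewrite ffunE. Qed.

Lemma parity_nat k : @has_parity R m n false k%:R.
Proof.
move=> U nU; elim: k => [|k IHk]; first by rewrite ffunE.
rewrite -addn1 natrD spD IHk add0r ffunE; case: (U =P _) => // eU.
by rewrite eU cards0 in nU.
Qed.

Lemma parity1 : @has_parity R m n false 1.
Proof. exact: (@parity_nat 1). Qed.

Lemma even_comm x y : has_parity false x -> x * y = y * x.
Proof. by move=> px; rewrite (parity_comm y px). Qed.

End Generators.

(** * Superderivations *)

Section Derivations.
Variables (R : comNzRingType) (m n : nat).
Local Notation SP := (superpoly R m n).
Implicit Types (b : bool) (D : SP -> SP) (x y : SP).

(** A superderivation as a property of a map, rather than in the form [sder u w], so
    that one argument covers the operators L_a, iota_a and d and the adjoint action,
    whose coefficients u and w differ. *)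
Definition superder b D : Prop :=
  linear D /\ forall x y, D (x * y) = D x * y + iter b (@grade R m n) x * D y.

Lemma sder_superder b u w :
    (forall i, has_parity b (u i)) -> (forall j, has_parity (~~ b) (w j)) ->
  superder b (@sder R m n u w).
Proof. by move=> hu hw; split; [exact: sder_is_linear | exact: sderM]. Qed.

Section Theory.
Variables (b : bool) (D : SP -> SP).
Hypothesis hD : superder b D.

Lemma superderD x y : D (x + y) = D x + D y.
Proof. by have := hD.1 1 x y; rewrite !scale1r. Qed.

Lemma superder0 : D 0 = 0.
Proof. by apply: (addIr (D 0)); rewrite -superderD !add0r. Qed.

Lemma superderZ a x : D (a *: x) = a *: D x.
Proof. by have := hD.1 a x 0; rewrite superder0 !addr0. Qed.

Lemma superderN x : D (- x) = - D x.
Proof. by rewrite -scaleN1r superderZ scaleN1r. Qed.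

Lemma superder_sum I (r : seq I) (F : I -> SP) :
  D (\sum_(i <- r) F i) = \sum_(i <- r) D (F i).
Proof. exact: (big_morph D superderD superder0). Qed.

Lemma superder_mul_even x y : has_parity false x -> D (x * y) = D x * y + x * D y.
Proof.
move=> px; rewrite hD.2; case: b => //=.
by rewrite (grade_parity px) scale1r.
Qed.

Lemma superder_mul_odd x y : has_parity true x ->
  D (x * y) = D x * y + (-1) ^+ b *: (x * D y).
Proof.
move=> px; rewrite hD.2; case: b => /=; last by rewrite scale1r.
by rewrite (grade_parity px) scalerAl.
Qed.

Lemma superder1 : D 1 = 0.
Proof.
have := superder_mul_even 1 (@parity1 R m n); rewrite !mulr1 mul1r.
by move/(congr1 (fun z => z - D 1)); rewrite subrr addrK.
Qed.

End Theory.
End Derivations.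

Lemma lrmorphism_gen_ext (R : comNzRingType) (m n : nat) (A : algType R)
    (phi psi : {lrmorphism superpoly R m n -> A}) :
    (forall i, phi (sp_even R n i) = psi (sp_even R n i)) ->
    (forall j, phi (sp_odd R m j) = psi (sp_odd R m j)) ->
  phi =1 psi.
Proof.
move=> eE eO; apply: superpoly_gen_ind => [|a x y IHx IHy|i x IHx|j x IHx].
- by rewrite !rmorph1.
- by rewrite !linearP /= IHx IHy.
- by rewrite !rmorphM /= eE IHx.
- by rewrite !rmorphM /= eO IHx.
Qed.

(** The elements fixed modulo the ideal generated by t form a subalgebra:
    g x - phi(g) phi(x) = g (x - phi(x)) + (g - phi(g)) phi(x). *)
Lemma lrmorphism_cong (R : comNzRingType) (m n : nat)
    (phi : {lrmorphism superpoly R m n -> superpoly R m n}) (t : superpoly R m n) :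
    has_parity false t ->
    (forall i, exists z, sp_even R n i - phi (sp_even R n i) = t * z) ->
    (forall j, exists z, sp_odd R m j - phi (sp_odd R m j) = t * z) ->
  forall x, exists z, x - phi x = t * z.
Proof.
move=> pt eE eO.
have mul g x : (exists z, g - phi g = t * z) -> (exists z, x - phi x = t * z) ->
    exists z, g * x - phi (g * x) = t * z.
  move=> [z ez] [z' ez']; exists (g * z' + z * phi x).
  rewrite rmorphM mulrDr !mulrA -ez (even_comm g pt) -mulrA -ez' mulrBr mulrBl.
  by rewrite addrA subrK.
apply: superpoly_gen_ind => [|a x y [z ez] [z' ez']|i x|j x]; try exact: mul.
  by exists 0; rewrite rmorph1 subrr mulr0.
exists (a *: z + z'); rewrite linearP /= opprD addrACA -scalerBr ez ez' mulrDr.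
by rewrite scalerAr.
Qed.

(** The factor k records that D' may agree with D only up to an even element
    of the target: for the lift of W to S(Tg[1]~) below, k is the central element c. *)
Lemma superder_intertwine (R : comNzRingType) (m n m' n' : nat) (b : bool)
    (phi : {lrmorphism superpoly R m n -> superpoly R m' n'}) D D' k :
    superder b D -> superder b D' -> has_parity false k ->
    (forall i, has_parity false (phi (sp_even R n i))) ->
    (forall j, has_parity true (phi (sp_odd R m j))) ->
    (forall i, D' (phi (sp_even R n i)) = k * phi (D (sp_even R n i))) ->
    (forall j, D' (phi (sp_odd R m j)) = k * phi (D (sp_odd R m j))) ->
  forall x, D' (phi x) = k * phi (D x).
Proof.
move=> hD hD' pk pE pO eE eO; apply: superpoly_gen_ind => [|a x y IHx IHy|i x IHx|j x IHx].
- by rewrite rmorph1 (superder1 hD) (superder1 hD') raddf0 mulr0.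
- by rewrite linearP hD.1 hD'.1 linearP IHx IHy [RHS]mulrDr scalerAr.
- rewrite rmorphM [in LHS](superder_mul_even hD'); last exact: pE.
  rewrite [in RHS](superder_mul_even hD); last exact: parity_sp_even.
  by rewrite eE IHx rmorphD !rmorphM mulrDr !mulrA (even_comm (phi (sp_even R n i)) pk).
rewrite rmorphM [in LHS](superder_mul_odd hD'); last exact: pO.
rewrite [in RHS](superder_mul_odd hD); last exact: parity_odd.
rewrite eO IHx raddfD /= linearZ !rmorphM mulrDr -scalerAr !mulrA.
by rewrite (even_comm (phi (sp_odd R m j)) pk).
Qed.

Lemma superder_commute (R : comNzRingType) (m n m' n' : nat) (b : bool)
    (phi : {lrmorphism superpoly R m n -> superpoly R m' n'}) D D' :
    superder b D -> superder b D' ->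
    (forall i, has_parity false (phi (sp_even R n i))) ->
    (forall j, has_parity true (phi (sp_odd R m j))) ->
    (forall i, D' (phi (sp_even R n i)) = phi (D (sp_even R n i))) ->
    (forall j, D' (phi (sp_odd R m j)) = phi (D (sp_odd R m j))) ->
  forall x, D' (phi x) = phi (D x).
Proof.
move=> hD hD' pE pO eE eO x; rewrite -[RHS]mul1r.
apply: (superder_intertwine hD hD') => // [|i|j]; rewrite ?mul1r //.
exact: parity1.
Qed.

(** The cancellation of the mixed terms when two Leibniz rules are composed in both
    orders. *)
Lemma cross_cancel (V : zmodType) (p p' q q' u v : V) :
  (p - u + (v + q)) + (p' - v + (u + q')) = (p + p') + (q + q').
Proof.
rewrite addrACA [X in X + _]addrACA [X in _ + X]addrACA -opprD [v + u]addrC.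
by rewrite -addrA addKr.
Qed.

(** The anticommutator of two odd derivations is again an even derivation.  The
    parity conditions on generators give the mixed terms of the two compositions
    opposite signs. *)
Lemma superder_anticommutator (R : comNzRingType) (m n : nat) D1 D2 D3 :
    superder true D1 -> superder true D2 -> superder false D3 ->
    (forall i, has_parity true (D1 (sp_even R n i))) ->
    (forall j, has_parity false (D1 (sp_odd R m j))) ->
    (forall i, has_parity true (D2 (sp_even R n i))) ->
    (forall j, has_parity false (D2 (sp_odd R m j))) ->
    (forall i, D1 (D2 (sp_even R n i)) + D2 (D1 (sp_even R n i)) = D3 (sp_even R n i)) ->
    (forall j, D1 (D2 (sp_odd R m j)) + D2 (D1 (sp_odd R m j)) = D3 (sp_odd R m j)) ->
  forall x, D1 (D2 x) + D2 (D1 x) = D3 x.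
Proof.
move=> h1 h2 h3 e1 o1 e2 o2 eE eO; apply: superpoly_gen_ind => [|a x y IHx IHy|i x IHx|j x IHx].
- by rewrite (superder1 h1) (superder1 h2) (superder1 h3) (superder0 h1) (superder0 h2) addr0.
- by rewrite h1.1 h2.1 h1.1 h2.1 h3.1 addrACA -scalerDr IHx IHy.
- have leib D D' : superder true D -> superder true D' -> has_parity true (D' (sp_even R n i)) ->
      D (D' (sp_even R n i * x)) = D (D' (sp_even R n i)) * x - D' (sp_even R n i) * D x
        + (D (sp_even R n i) * D' x + sp_even R n i * D (D' x)).
    move=> h h' p'; rewrite (superder_mul_even h' x (@parity_sp_even R m n i)) (superderD h).
    rewrite (superder_mul_odd h x p') (superder_mul_even h _ (@parity_sp_even R m n i)).
    by rewrite expr1 scaleN1r.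
  rewrite (leib _ _ h1 h2 (e2 i)) (leib _ _ h2 h1 (e1 i)).
  rewrite (superder_mul_even h3 x (@parity_sp_even R m n i)) -eE -IHx mulrDl mulrDr.
  exact: cross_cancel.
have leib D D' : superder true D -> superder true D' -> has_parity false (D' (sp_odd R m j)) ->
    D (D' (sp_odd R m j * x)) = D (D' (sp_odd R m j)) * x + D' (sp_odd R m j) * D x
      + (- (D (sp_odd R m j) * D' x) + sp_odd R m j * D (D' x)).
  move=> h h' p'; rewrite (superder_mul_odd h' x (@parity_odd R m n j)) (superderD h).
  rewrite (superder_mul_even h x p') expr1 scaleN1r (superderN h).
  rewrite (superder_mul_odd h _ (@parity_odd R m n j)).
  by rewrite expr1 scaleN1r opprB [_ - D _ * _]addrC.
rewrite (leib _ _ h1 h2 (o2 j)) (leib _ _ h2 h1 (o1 j)).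
rewrite (superder_mul_odd h3 x (@parity_odd R m n j)) expr0 scale1r -eO -IHx mulrDl mulrDr.
have /(_ (- (D2 (sp_odd R m j) * D1 x)) (- (D1 (sp_odd R m j) * D2 x))) :=
  cross_cancel (D1 (D2 (sp_odd R m j)) * x) (D2 (D1 (sp_odd R m j)) * x)
    (sp_odd R m j * D1 (D2 x)) (sp_odd R m j * D2 (D1 x)).
by rewrite !opprK.
Qed.

(** * The quadratic elements 1/2 f_bcd theta^c theta^d *)

Section QuadraticElements.
Variables (R : realType) (n : nat) (f : 'I_n -> 'I_n -> 'I_n -> R).

(** [half_fthth] with any number m of even generators: it is needed both in the Weil
    algebra and in S(Tg[1]~). *)
Definition quad_th (m : nat) (b : 'I_n) : superpoly R m n :=
  2^-1 *: \sum_c \sum_d f b c d *: (sp_odd R m c * sp_odd R m d).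

Lemma quad_th_even m b : has_parity false (quad_th m b).
Proof.
apply/parityZ/parity_lin => c; apply: parity_lin => d; apply: parityZ.
rewrite /sp_odd sp_monoM => U nU; rewrite ffunE; case: (U =P _) => // eU.
move: nU; rewrite eU cardsU1 cards1 inE /ext_sign disjoints1 inE.
by case: (c == d); rewrite ?mul0r.
Qed.

Lemma rmorph_quad_th m m' (phi : {lrmorphism superpoly R m n -> superpoly R m' n}) b :
  (forall j, phi (sp_odd R m j) = sp_odd R m' j) -> phi (quad_th m b) = quad_th m' b.
Proof.
move=> phiO; rewrite /quad_th linearZ /= raddf_sum /=; congr (_ *: _); apply: eq_bigr => c _.
rewrite raddf_sum /=; apply: eq_bigr => d _.
by rewrite linearZ /= rmorphM /= !phiO.
Qed.

Hypothesis fC : forall a b c, f a b c = - f b a c.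
Hypothesis f_cyc : forall a b c, f a b c = f b c a.
(* ad(e_a) is a derivation of the bracket: the three sums are the coefficients on e_d
   of [a, [b, c]], of - [b, [a, c]] and of [[a, b], c]. *)
Hypothesis f_jacobi : forall a b c d,
  \sum_e f b c e * f a e d + \sum_e f b e d * f a e c = \sum_e f a b e * f e c d.

(** The structure constants are an invariant tensor, so the quadratic elements
    transform in the adjoint representation, like the generators. *)
Lemma superder_quad_th_ad m D a b :
    superder false D ->
    (forall b, D (sp_odd R m b) = \sum_c f a b c *: sp_odd R m c) ->
  D (quad_th m b) = \sum_c f a b c *: quad_th m c.
Proof.
move=> hD DO; rewrite /quad_th (superderZ hD) (superder_sum hD).
under eq_bigr => c _.
  rewrite (superder_sum hD); under eq_bigr => d _.
    rewrite (superderZ hD) (superder_mul_odd hD); last exact: parity_odd.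
    rewrite !DO expr0 scale1r mulr_suml mulr_sumr scalerDr !scaler_sumr.
    under eq_bigr => e _ do rewrite -scalerAl scalerA.
    under [X in _ + X]eq_bigr => e _ do rewrite -scalerAr scalerA.
  over.
  rewrite big_split /=.
over.
rewrite big_split /= exchange_big /=.
under eq_bigr => d _ do rewrite exchange_big /=.
rewrite exchange_big /=.
under [X in _ + X]eq_bigr => c _ do rewrite exchange_big /=.
rewrite -big_split /=.
under [RHS]eq_bigr => e _ do rewrite scalerA mulrC -scalerA scaler_sumr.
rewrite -scaler_sumr exchange_big /=; congr (_ *: _).
apply: eq_bigr => c _; rewrite -big_split /=.
under [RHS]eq_bigr => e _ do rewrite scaler_sumr.
rewrite exchange_big /=; apply: eq_bigr => d _.
under [RHS]eq_bigr => e _ do rewrite scalerA.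
by rewrite -!scaler_suml -scalerDl addrC f_jacobi.
Qed.

(** Contracting either of the two odd factors gives the same term, which cancels the
    factor 1/2.  In W this is iota_a with k = 1, in S(Tg[1]~) it is ad(\bar e_a)
    with k = c. *)
Lemma superder_quad_th_contract m D a b k :
    superder true D -> has_parity false k ->
    (forall b, D (sp_odd R m b) = (a == b)%:R *: k) ->
  D (quad_th m b) = - (k * \sum_c f a b c *: sp_odd R m c).
Proof.
move=> hD pk DO; rewrite /quad_th (superderZ hD) (superder_sum hD).
under eq_bigr => c _.
  rewrite (superder_sum hD); under eq_bigr => d _.
    rewrite (superderZ hD) (superder_mul_odd hD); last exact: parity_odd.
    rewrite !DO expr1 scaleN1r -scalerAl -scalerAr scalerBr !scalerA.
    rewrite -(even_comm (sp_odd R m c) pk).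
  over.
  rewrite big_split /=.
over.
rewrite big_split /= (bigD1 a) //= [X in _ + X + _]big1 ?addr0; last first.
  by move=> c nca; apply: big1 => d _; rewrite eq_sym (negbTE nca) mulr0 scale0r.
under [X in _ + X]eq_bigr => c _.
  rewrite (bigD1 a) //= [X in _ + X]big1 ?addr0; last first.
    by move=> d nda; rewrite eq_sym (negbTE nda) mulr0 scale0r oppr0.
over.
rewrite -big_split /= mulr_sumr -sumrN scaler_sumr; apply: eq_bigr => c _.
rewrite eqxx !mulr1 -scalerAr -scalerBl scalerA -scaleNr; congr (_ *: _).
rewrite (fC b a) [f b c a]f_cyc [f c a b]f_cyc.
by rewrite -opprD mulrN -mulr2n -[f a b c *+ 2]mulr_natl mulKf ?pnatr_eq0.
Qed.

End QuadraticElements.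

(** * Structure constants in an orthonormal basis *)

Section StructureConstants.
Variables (R : realType) (g : vectType R) (G : quadratic_lie g).
Variables (n : nat) (e : n.-tuple g).
Hypothesis e_orthonormal : orthonormal_basis G e.
Local Notation f := (structure_const G e).
Local Notation lie := (lie G).
Local Notation form := (Defs.form G).

Let formDl x y z : form (x + y) z = form x z + form y z.
Proof. by have := form_linearl G z 1 x y; rewrite scale1r mul1r. Qed.

Let form0l z : form 0 z = 0.
Proof. by apply: (addIr (form 0 z)); rewrite -formDl !add0r. Qed.

Let formZl a x z : form (a *: x) z = a * form x z.
Proof. by have := form_linearl G z a x 0; rewrite !addr0 form0l addr0. Qed.

Let lieDl x y z : lie (x + y) z = lie x z + lie y z.
Proof. by have := lie_linearl G z 1 x y; rewrite !scale1r. Qed.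

Let lieDr x y z : lie x (y + z) = lie x y + lie x z.
Proof. by have := lie_linearr G x 1 y z; rewrite !scale1r. Qed.

Let lie0r x : lie x 0 = 0.
Proof. by apply: (addIr (lie x 0)); rewrite -lieDr !add0r. Qed.

Let lieZr a x y : lie x (a *: y) = a *: lie x y.
Proof. by have := lie_linearr G x a y 0; rewrite !addr0 lie0r addr0. Qed.

Lemma lieC x y : lie x y = - lie y x.
Proof.
apply/eqP; rewrite -addr_eq0; apply/eqP.
by have := lie_alt G (x + y); rewrite lieDl !lieDr !lie_alt add0r addr0.
Qed.

Let formNl x z : form (- x) z = - form x z.
Proof. by rewrite -scaleN1r formZl mulN1r. Qed.

Lemma orthonormal_expand x : x = \sum_c form x (tnth e c) *: tnth e c.
Proof.
have [be on] := e_orthonormal.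
rewrite {1}(coord_basis be (memvf x)); apply: eq_bigr => c _; congr (_ *: _); last first.
  by rewrite (tnth_nth 0).
rewrite {2}(coord_basis be (memvf x)).
rewrite (big_morph (form^~ (tnth e c)) (fun x y => formDl x y _) (form0l _)).
rewrite (bigD1 c) //= formZl -tnth_nth on eqxx mulr1 big1 ?addr0 // => d ndc.
by rewrite formZl -tnth_nth on (negbTE ndc) mulr0.
Qed.

Lemma structure_constC a b c : f a b c = - f b a c.
Proof. by rewrite /structure_const lieC formNl. Qed.

Lemma structure_const_cycle a b c : f a b c = f b c a.
Proof. by rewrite /structure_const form_ad form_sym. Qed.

Lemma form_lie_lie a b c d :
  form (lie (tnth e a) (lie (tnth e b) (tnth e c))) (tnth e d) =
  \sum_k f b c k * f a k d.
Proof.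
rewrite [lie (tnth e b) _]orthonormal_expand.
rewrite (big_morph (lie (tnth e a)) (lieDr _) (lie0r _)).
rewrite (big_morph (form^~ (tnth e d)) (fun x y => formDl x y _) (form0l _)).
by apply: eq_bigr => k _; rewrite lieZr formZl.
Qed.

Lemma structure_const_jacobi a b c d :
  \sum_k f b c k * f a k d + \sum_k f b k d * f a k c = \sum_k f a b k * f k c d.
Proof.
have := lie_jacobi G (tnth e a) (tnth e b) (tnth e c).
move/(congr1 (form^~ (tnth e d))); rewrite !formDl form0l !form_lie_lie => jac.
apply/eqP; rewrite -subr_eq0 -[X in _ == X]jac -sumrN; apply/eqP.
congr (_ + _ + _); apply: eq_bigr => k _.
  by rewrite mulrC [f a k c]structure_const_cycle [f k c a]structure_const_cycle.
by rewrite [f k c d]structure_constC mulrN opprK.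
Qed.

End StructureConstants.

(** * Intertwining properties of tau0 and of the specialisation c = 1 *)

Section InvariantsAndBasicElements.
Variables (R : realType) (n : nat) (f : 'I_n -> 'I_n -> 'I_n -> R).
Hypothesis fC : forall a b c, f a b c = - f b a c.
Hypothesis f_cyc : forall a b c, f a b c = f b c a.
Hypothesis f_jacobi : forall a b c d,
  \sum_e f b c e * f a e d + \sum_e f b e d * f a e c = \sum_e f a b e * f e c d.

Local Notation ev := (sp_even R n).
Local Notation od m := (@sp_odd R m n).
Local Notation eT a := (ev (lift ord0 a)).

Lemma parity_sum_odd m (a b : 'I_n) : has_parity true (\sum_c f a b c *: od m c).
Proof. by apply: parity_lin => c; apply/parityZ/parity_odd. Qed.

Lemma parity_sum_even m (a b : 'I_n) (h : 'I_n -> 'I_m) :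
  has_parity false (\sum_c f a b c *: ev (h c)).
Proof. by apply: parity_lin => c; apply/parityZ/parity_sp_even. Qed.

Lemma W_L_superder a : superder false (W_L f a : superpoly R n n -> superpoly R n n).
Proof.
by apply: sder_superder => b; [exact: (parity_sum_even _ _ id) | exact: parity_sum_odd].
Qed.

Lemma W_iota_superder a : superder true (@W_iota R n a : superpoly R n n -> superpoly R n n).
Proof. by apply: sder_superder => b; [exact: parity0 | exact: parity_nat]. Qed.

Lemma WK_iota_superder a : superder true (WK_iota f a : superpoly R n n -> superpoly R n n).
Proof. by apply: sder_superder => b; [exact: parity_sum_odd | exact: parity_nat]. Qed.

Lemma WK_d_superder : superder true (@WK_d R n : superpoly R n n -> superpoly R n n).
Proof. by apply: sder_superder => b; [exact: parity0 | exact: parity_sp_even]. Qed.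

Lemma Tg_adE_superder a :
  superder false (Tg_ad_basis f (TgE a) : superpoly R n.+1 n -> superpoly R n.+1 n).
Proof.
apply: sder_superder => b; last exact: parity_sum_odd.
rewrite /even_basis; case: unlift => [c|] /=; last exact: parity0.
exact: (parity_sum_even _ _ (lift ord0)).
Qed.

Lemma Tg_adO_superder a :
  superder true (Tg_ad_basis f (TgO a) : superpoly R n.+1 n -> superpoly R n.+1 n).
Proof.
apply: sder_superder => b; last exact/parityZ/parity_sp_even.
rewrite /even_basis; case: unlift => [c|] /=; last exact: parity0.
exact: parity_sum_odd.
Qed.

Lemma sp_nat (m : nat) (b : bool) : b%:R = b%:R *: 1 :> superpoly R m n.
Proof. by rewrite scaler_nat. Qed.

Lemma tau0_even b : tau0 f (ev b) = ev b - quad_th f n b.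
Proof. exact: sp_lift_even. Qed.

Lemma tau0_odd b : tau0 f (od n b) = od n b.
Proof. exact: sp_lift_odd. Qed.

Lemma tau0_even_parity b : has_parity false (tau0 f (ev b)).
Proof.
by move=> U nU; rewrite tau0_even spD spN parity_sp_even // quad_th_even // subr0.
Qed.

Lemma tau0_odd_parity b : has_parity true (tau0 f (od n b)).
Proof. by rewrite tau0_odd; exact: parity_odd. Qed.

Lemma W_L_even a b : W_L f a (ev b) = \sum_c f a b c *: ev c.
Proof. exact: sder_even. Qed.

Lemma W_L_odd a b : W_L f a (od n b) = \sum_c f a b c *: od n c.
Proof. exact: sder_odd. Qed.

Lemma tau0_L a x : W_L f a (tau0 f x) = tau0 f (W_L f a x).
Proof.
apply: (@superder_commute R n n n n false (tau0 f)) => [||||b|b].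
- exact: W_L_superder.
- exact: W_L_superder.
- exact: tau0_even_parity.
- exact: tau0_odd_parity.
- rewrite /= tau0_even (superderD (W_L_superder a)) (superderN (W_L_superder a)).
  rewrite (superder_quad_th_ad f_jacobi b (W_L_superder a) (W_L_odd a)) W_L_even.
  rewrite [RHS]raddf_sum -sumrN -big_split /=; apply: eq_bigr => c _.
  by rewrite [RHS]linearZ /= tau0_even scalerBr.
- rewrite /= tau0_odd W_L_odd raddf_sum /=; apply: eq_bigr => c _.
  by rewrite linearZ /= tau0_odd.
Qed.

(** The quadratic correction in tau0 is what turns the operator iota_a of W^K, which
    sends v^b to f_abc theta^c, into the plain contraction of W. *)
Lemma tau0_iota a x : W_iota a (tau0 f x) = tau0 f (WK_iota f a x).
Proof.
have iota_odd b : W_iota a (od n b) = (a == b)%:R *: 1 :> superpoly R n n.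
  by rewrite -sp_nat; exact: sder_odd.
apply: (@superder_commute R n n n n true (tau0 f)) => [||||b|b].
- exact: WK_iota_superder.
- exact: W_iota_superder.
- exact: tau0_even_parity.
- exact: tau0_odd_parity.
- rewrite /= tau0_even (superderD (W_iota_superder a)) (superderN (W_iota_superder a)).
  rewrite (superder_quad_th_contract fC f_cyc b (W_iota_superder a) (@parity1 R n n) iota_odd).
  rewrite opprK mul1r [W_iota a (ev b)]sder_even add0r [WK_iota f a (ev b)]sder_even.
  rewrite raddf_sum /=; apply: eq_bigr => c _.
  by rewrite linearZ /= tau0_odd.
- by rewrite /= tau0_odd iota_odd [WK_iota f a (od n b)]sder_odd rmorph_nat sp_nat.
Qed.

Definition tau0_inv : weil R n -> weil R n := sp_lift (fun b => ev b + quad_th f n b) (od n).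

Lemma even_shift_parity b : has_parity false (ev b + quad_th f n b).
Proof. by move=> U nU; rewrite spD parity_sp_even // quad_th_even // addr0. Qed.

HB.instance Definition _ :=
  GRing.isLinear.Build R (weil R n) (weil R n) _ tau0_inv
    (@sp_lift_is_linear R n n (weil R n) _ _).
HB.instance Definition _ :=
  GRing.isMonoidMorphism.Build (weil R n) (weil R n) tau0_inv
    (sp_lift_monoid_morphism even_shift_parity).

Lemma tau0K : cancel (tau0 f) tau0_inv.
Proof.
apply: (@lrmorphism_gen_ext R n n _ (tau0_inv \o tau0 f) idfun) => b /=.
  rewrite tau0_even raddfB /= rmorph_quad_th; last exact: sp_lift_odd.
  by rewrite [tau0_inv (ev b)]sp_lift_even addrK.
by rewrite tau0_odd; exact: sp_lift_odd.
Qed.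

Lemma WK_basicE w : WK_basic f w <-> W_basic f (tau0 f w).
Proof.
split=> bw a; have [iw Lw] := bw a.
  by rewrite tau0_iota tau0_L iw [W_L f a w]Lw !raddf0.
split; apply: (can_inj tau0K); rewrite raddf0; first by rewrite -tau0_iota.
by rewrite -[LHS]tau0_L.
Qed.

Lemma set_c1_c : @set_c1 R n (ev ord0) = 1.
Proof. by rewrite [LHS]sp_lift_even unlift_none. Qed.

Lemma set_c1_even b : @set_c1 R n (eT b) = ev b.
Proof. by rewrite [LHS]sp_lift_even liftK. Qed.

Lemma set_c1_odd b : @set_c1 R n (od n.+1 b) = od n b.
Proof. exact: sp_lift_odd. Qed.

Lemma set_c1_even_parity i : has_parity false (@set_c1 R n (ev i)).
Proof.
case: (unliftP ord0 i) => [b ->|->]; first by rewrite set_c1_even; exact: parity_sp_even.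
by rewrite set_c1_c; exact: parity1.
Qed.

Lemma set_c1_odd_parity b : has_parity true (@set_c1 R n (od n.+1 b)).
Proof. by rewrite set_c1_odd; exact: parity_odd. Qed.

Lemma Tg_ad_c b : Tg_ad_basis f b (ev ord0) = 0.
Proof. by rewrite [LHS](Tg_ad_gen f b TgC); case: b. Qed.

Lemma Tg_adE_even a b : Tg_ad_basis f (TgE a) (eT b) = \sum_c f a b c *: eT c.
Proof. exact: (Tg_ad_gen f (TgE a) (TgE b)). Qed.

Lemma Tg_adE_odd a b : Tg_ad_basis f (TgE a) (od n.+1 b) = \sum_c f a b c *: od n.+1 c.
Proof. exact: (Tg_ad_gen f (TgE a) (TgO b)). Qed.

Lemma Tg_adO_even a b : Tg_ad_basis f (TgO a) (eT b) = \sum_c f a b c *: od n.+1 c.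
Proof. exact: (Tg_ad_gen f (TgO a) (TgE b)). Qed.

Lemma Tg_adO_odd a b : Tg_ad_basis f (TgO a) (od n.+1 b) = (a == b)%:R *: ev ord0.
Proof. exact: (Tg_ad_gen f (TgO a) (TgO b)). Qed.

Lemma set_c1_adE a x : WK_L f a (set_c1 x) = set_c1 (Tg_ad_basis f (TgE a) x).
Proof.
apply: (@superder_commute R n.+1 n n n false (@set_c1 R n)) => [||||i|b] /=.
- exact: Tg_adE_superder.
- exact: W_L_superder.
- exact: set_c1_even_parity.
- exact: set_c1_odd_parity.
- case: (unliftP ord0 i) => [b ->|->].
    rewrite set_c1_even Tg_adE_even [LHS]W_L_even raddf_sum /=; apply: eq_bigr => c _.
    by rewrite linearZ /= set_c1_even.
  by rewrite set_c1_c Tg_ad_c raddf0; exact: (superder1 (W_L_superder a)).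
- rewrite set_c1_odd Tg_adE_odd [LHS]W_L_odd raddf_sum /=; apply: eq_bigr => c _.
  by rewrite linearZ /= set_c1_odd.
Qed.

Lemma set_c1_adO a x : WK_iota f a (set_c1 x) = set_c1 (Tg_ad_basis f (TgO a) x).
Proof.
apply: (@superder_commute R n.+1 n n n true (@set_c1 R n)) => [||||i|b] /=.
- exact: Tg_adO_superder.
- exact: WK_iota_superder.
- exact: set_c1_even_parity.
- exact: set_c1_odd_parity.
- case: (unliftP ord0 i) => [b ->|->].
    rewrite set_c1_even Tg_adO_even [LHS]sder_even raddf_sum /=; apply: eq_bigr => c _.
    by rewrite linearZ /= set_c1_odd.
  by rewrite set_c1_c Tg_ad_c raddf0; exact: (superder1 (WK_iota_superder a)).
- by rewrite set_c1_odd Tg_adO_odd linearZ /= set_c1_c [LHS]sder_odd sp_nat.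
Qed.

(** * Lifting basic elements to invariants *)

(** The element u_b.  The factor c makes it homogeneous, as \bar e has weight 1 and c
    weight 2: then ad(\bar e_a) (c e_b) = c f_abc \bar e_c cancels the contraction
    of the quadratic term. *)
Definition horizontal_gen b : superpoly R n.+1 n := ev ord0 * eT b + quad_th f n.+1 b.

Definition horizontal_lift : weil R n -> STg R n := sp_lift horizontal_gen (od n.+1).

Lemma horizontal_gen_even b : has_parity false (horizontal_gen b).
Proof.
rewrite /horizontal_gen => U nU; rewrite spD quad_th_even // addr0.
by rewrite /sp_even -sp_mono0_mul ffunE; case: (U =P _) => // eU; rewrite eU cards0 in nU.
Qed.

HB.instance Definition _ :=
  GRing.isLinear.Build R (weil R n) (STg R n) _ horizontal_lift
    (@sp_lift_is_linear R n n (STg R n) _ _).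
HB.instance Definition _ :=
  GRing.isMonoidMorphism.Build (weil R n) (STg R n) horizontal_lift
    (sp_lift_monoid_morphism horizontal_gen_even).

Lemma horizontal_lift_even b : horizontal_lift (ev b) = horizontal_gen b.
Proof. exact: sp_lift_even. Qed.

Lemma horizontal_lift_odd b : horizontal_lift (od n b) = od n.+1 b.
Proof. exact: sp_lift_odd. Qed.

Lemma sigma0_horizontal_lift w : sigma0 f (horizontal_lift w) = w.
Proof.
move: w; apply: (@lrmorphism_gen_ext R n n _ (sigma0 f \o horizontal_lift) idfun) => b /=.
  rewrite horizontal_lift_even rmorphD rmorphM /= /sigma0 set_c1_c rmorph1 mul1r set_c1_even.
  rewrite tau0_even !rmorph_quad_th ?subrK // => j; first exact: tau0_odd.
  exact: set_c1_odd.
by rewrite horizontal_lift_odd /sigma0 set_c1_odd tau0_odd.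
Qed.

Lemma horizontal_lift_adE a w :
  Tg_ad_basis f (TgE a) (horizontal_lift w) = horizontal_lift (W_L f a w).
Proof.
apply: (@superder_commute R n n n.+1 n false horizontal_lift) => [||||b|b] /=.
- exact: W_L_superder.
- exact: Tg_adE_superder.
- by move=> b; rewrite horizontal_lift_even; exact: horizontal_gen_even.
- by move=> b; rewrite horizontal_lift_odd; exact: parity_odd.
- rewrite horizontal_lift_even (superderD (Tg_adE_superder a)).
  rewrite (superder_mul_even (Tg_adE_superder a)); last exact: parity_sp_even.
  rewrite (superder_quad_th_ad f_jacobi b (Tg_adE_superder a) (Tg_adE_odd a)).
  rewrite Tg_ad_c mul0r add0r Tg_adE_even W_L_even mulr_sumr raddf_sum -big_split /=.
  apply: eq_bigr => c _.
  by rewrite [RHS]linearZ /= horizontal_lift_even scalerDr scalerAr.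
- rewrite horizontal_lift_odd W_L_odd raddf_sum /= Tg_adE_odd; apply: eq_bigr => c _.
  by rewrite linearZ /= horizontal_lift_odd.
Qed.

(** On the \bar e_b this reads ad(\bar e_a) \bar e_b = delta_ab c, which is where the
    factor c comes from; the u_b are killed on both sides. *)
Lemma horizontal_lift_adO a w :
  Tg_ad_basis f (TgO a) (horizontal_lift w) = STg_c R n * horizontal_lift (W_iota a w).
Proof.
have iota_odd b : W_iota a (od n b) = (a == b)%:R *: 1 :> superpoly R n n.
  by rewrite -sp_nat; exact: sder_odd.
apply: (@superder_intertwine R n n n.+1 n true horizontal_lift) => [|||||b|b] /=.
- exact: W_iota_superder.
- exact: Tg_adO_superder.
- exact: parity_sp_even.
- by move=> b; rewrite horizontal_lift_even; exact: horizontal_gen_even.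
- by move=> b; rewrite horizontal_lift_odd; exact: parity_odd.
- rewrite horizontal_lift_even (superderD (Tg_adO_superder a)).
  rewrite (superder_mul_even (Tg_adO_superder a)); last exact: parity_sp_even.
  rewrite (superder_quad_th_contract fC f_cyc b (Tg_adO_superder a) _ (Tg_adO_odd a)).
    by rewrite Tg_ad_c mul0r add0r Tg_adO_even subrr [W_iota a _]sder_even raddf0 mulr0.
  exact: parity_sp_even.
- by rewrite horizontal_lift_odd Tg_adO_odd iota_odd linearZ /= rmorph1 -scalerAr mulr1.
Qed.

(** * The kernel of c = 1 *)

(** The section of c = 1 that takes the representative free of c. *)
Definition unset_c1 : weil R n -> STg R n := sp_lift (fun b => eT b) (od n.+1).

HB.instance Definition _ :=
  GRing.isLinear.Build R (weil R n) (STg R n) _ unset_c1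
    (@sp_lift_is_linear R n n (STg R n) _ _).
HB.instance Definition _ :=
  GRing.isMonoidMorphism.Build (weil R n) (STg R n) unset_c1
    (sp_lift_monoid_morphism (fun b => @parity_sp_even R n.+1 n (lift ord0 b))).

Lemma parity_c1 : @has_parity R n.+1 n false (STg_c R n - 1).
Proof. by move=> U nU; rewrite spD spN (@parity1 R) // parity_sp_even // subr0. Qed.

(** Every x is congruent modulo c - 1 to its representative free of c, so the kernel
    of [set_c1] is no larger than the ideal generated by c - 1. *)
Lemma c1_congP (p q : STg R n) : c1_cong p q <-> set_c1 p = set_c1 q.
Proof.
split=> [[z epq]|epq].
  apply/eqP; rewrite -subr_eq0 -raddfB /= epq rmorphM rmorphB rmorph1 /=.
  by rewrite [set_c1 (STg_c R n)]set_c1_c subrr mul0r.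
have cong x : exists z, x - unset_c1 (set_c1 x) = (STg_c R n - 1) * z.
  apply: (@lrmorphism_cong R n.+1 n (unset_c1 \o @set_c1 R n)) => [|i|b] /=.
  - exact: parity_c1.
  - case: (unliftP ord0 i) => [b ->|->].
      by exists 0; rewrite set_c1_even [unset_c1 _]sp_lift_even subrr mulr0.
    by exists 1; rewrite set_c1_c rmorph1 mulr1.
  - by exists 0; rewrite set_c1_odd [unset_c1 _]sp_lift_odd subrr mulr0.
have [z ez] := cong p; have [z' ez'] := cong q; exists (z - z').
by rewrite mulrBr -ez -ez' epq opprB addrA subrK.
Qed.

Lemma c1_regular (z : STg R n) : (STg_c R n - 1) * z = 0 -> z = 0.
Proof.
have -> : STg_c R n - 1 = sp_mono ('X_ord0 - 1) set0.
  by apply/ffunP=> U; rewrite spD spN !ffunE; case: ifP; rewrite ?subr0.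
move=> cz0; apply/ffunP=> U; move/ffunP/(_ U): cz0; rewrite sp_mono0M !ffunE.
move/eqP; rewrite mulf_eq0 => /orP[|/eqP //]; rewrite subr_eq0 => /eqP.
move/(congr1 (mcoeff U_(ord0))); rewrite mcoeffXU mcoeff1 eqxx.
suff /negbTE -> : U_(ord0 : 'I_n.+1)%MM != 0%MM by move/eqP; rewrite oner_eq0.
by rewrite -mdeg_eq0 mdeg1.
Qed.

Lemma Tg_ad_basis_c p : Tg_ad_basis f TgC p = 0.
Proof. by rewrite /Tg_ad_basis /sder !big1 ?addr0 // => i _; rewrite mul0r. Qed.

Lemma Tg_ad_TgE a p :
  Tg_ad f (fun b => if b is TgE a' then (a == a')%:R else 0) p = Tg_ad_basis f (TgE a) p.
Proof.
rewrite /Tg_ad scale0r addr0 [X in _ + X]big1 ?addr0 => [|b _]; last by rewrite scale0r.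
rewrite (bigD1 a) //= eqxx scale1r big1 ?addr0 // => b nba.
by rewrite eq_sym (negbTE nba) scale0r.
Qed.

Lemma Tg_ad_TgO a p :
  Tg_ad f (fun b => if b is TgO a' then (a == a')%:R else 0) p = Tg_ad_basis f (TgO a) p.
Proof.
rewrite /Tg_ad scale0r addr0 big1 ?add0r => [|b _]; last by rewrite scale0r.
rewrite (bigD1 a) //= eqxx scale1r big1 ?addr0 // => b nba.
by rewrite eq_sym (negbTE nba) scale0r.
Qed.

Lemma STg_invP p : STg_inv f p <->
  forall a, Tg_ad_basis f (TgE a) p = 0 /\ Tg_ad_basis f (TgO a) p = 0.
Proof.
split=> [inv a|inv x]; first by rewrite -Tg_ad_TgE -Tg_ad_TgO !inv.
rewrite /Tg_ad Tg_ad_basis_c scaler0 addr0 !big1 ?addr0 // => a _.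
  by rewrite (inv a).2 scaler0.
by rewrite (inv a).1 scaler0.
Qed.

Lemma STg_c1_invP p : STg_c1_inv f p <-> WK_basic f (set_c1 p).
Proof.
split=> [inv a|bp x].
  rewrite set_c1_adE set_c1_adO -Tg_ad_TgE -Tg_ad_TgO.
  by split; rewrite (iffLR (c1_congP _ _) (inv _)) raddf0.
apply/c1_congP; rewrite raddf0 /Tg_ad Tg_ad_basis_c scaler0 addr0.
rewrite raddfD /= [X in X + _]raddf_sum [X in _ + X]raddf_sum /=.
rewrite [X in X + _]big1 => [|a _]; last by rewrite linearZ /= -set_c1_adE (bp a).2 scaler0.
rewrite add0r big1 // => a _.
by rewrite linearZ /= -set_c1_adO (bp a).1 scaler0.
Qed.

Lemma STg_inv_c1_inv p : STg_inv f p -> STg_c1_inv f p.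
Proof. by move=> inv x; apply/c1_congP; rewrite inv. Qed.

(** If (c - 1) z is invariant, then 0 = D ((c - 1) z) = (c - 1) D z for each D in the
    action, and c - 1 is not a zero divisor. *)
Lemma inv_c1_congP p q : STg_inv f p -> STg_inv f q ->
  (inv_c1_cong f p q <-> set_c1 p = set_c1 q).
Proof.
move=> /STg_invP ip /STg_invP iq; split=> [[z _ epq]|].
  by apply/c1_congP; exists z.
move/c1_congP=> [z epq]; exists z => //; apply/STg_invP => a.
have reg b D : superder b D -> D (STg_c R n) = 0 -> D p = 0 -> D q = 0 -> D z = 0.
  move=> hD Dc Dp Dq; apply: c1_regular.
  have := superder_mul_even hD z parity_c1.
  rewrite (superderD hD) (superderN hD) Dc (superder1 hD) subrr mul0r add0r => <-.
  by rewrite -epq (superderD hD) (superderN hD) Dp Dq subrr.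
have [[ipE ipO] [iqE iqO]] := (ip a, iq a).
split; first exact: (reg _ _ (Tg_adE_superder a) (Tg_ad_c (TgE a)) ipE iqE).
exact: (reg _ _ (Tg_adO_superder a) (Tg_ad_c (TgO a)) ipO iqO).
Qed.

Lemma horizontal_lift_inv w : W_basic f w -> STg_inv f (horizontal_lift w).
Proof.
move=> bw; apply/STg_invP => a; have [iw Lw] := bw a.
by rewrite horizontal_lift_adE horizontal_lift_adO iw Lw !raddf0 mulr0.
Qed.

Lemma set_c1_horizontal_lift w : WK_basic f w -> set_c1 (horizontal_lift (tau0 f w)) = w.
Proof. by move=> bw; apply: (can_inj tau0K); exact: sigma0_horizontal_lift. Qed.

(** * Basic elements are the invariant polynomials in v *)

(** In W the contraction iota_a is the derivative in theta^a, and the coefficient of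
    theta_U with a in U is recovered, up to sign, from the coefficient of
    theta_(U :\ a) in that derivative. *)
Lemma W_basic_mono (w : weil R n) : (forall a, W_iota a w = 0) -> w = sp_mono (w set0) set0.
Proof.
move=> iw; apply/ffunP=> U; rewrite ffunE; case: eqP => [-> //|/eqP/set0Pn[a aU]].
have /ffunP/(_ (U :\ a)) : sp_dodd a w = 0.
  rewrite -(iw a) /W_iota /sder big1 ?add0r => [|b _]; last by rewrite mul0r.
  rewrite (bigD1 a) //= eqxx mul1r big1 ?addr0 // => b nba.
  by rewrite eq_sym (negbTE nba) mul0r.
rewrite sp_doddE !inE eqxx /= setD1K // ffunE => /eqP.
by rewrite mulf_eq0 signr_eq0 => /eqP.
Qed.

Lemma W_iota_mono a p : W_iota a (sp_mono p set0) = 0 :> weil R n.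
Proof.
rewrite /W_iota /sder big1 ?add0r => [|b _]; last by rewrite mul0r.
by apply: big1 => b _; rewrite sp_doddC mulr0.
Qed.

Lemma sp_deven_mono i p : sp_deven i (sp_mono p set0) = sp_mono p^`M(i) set0 :> superpoly R n n.
Proof. by apply/ffunP=> U; rewrite !ffunE; case: ifP; rewrite ?linear0. Qed.

Lemma W_L_mono a p : W_L f a (sp_mono p set0) = sp_mono (Sg_ad_basis f a p) set0.
Proof.
rewrite /W_L /sder [X in _ + X]big1 ?addr0 => [|b _]; last by rewrite sp_doddC mulr0.
have mono_sum := big_morph (fun q => sp_mono q set0 : superpoly R n n)
  (fun p q => sp_monoD p q set0) (sp_mono0 _ _ _).
rewrite /Sg_ad_basis mono_sum; apply: eq_bigr => b _.
rewrite sp_deven_mono sp_mono0_mul; congr (_ * _); rewrite mono_sum.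
by apply: eq_bigr => c _; rewrite sp_monoZ.
Qed.

Lemma Sg_invP p : Sg_inv f p <-> forall a, Sg_ad_basis f a p = 0.
Proof.
split=> inv => [a|x]; last by rewrite /Sg_ad big1 // => a _; rewrite inv scaler0.
rewrite -(inv (fun b => (a == b)%:R)) /Sg_ad (bigD1 a) //= eqxx scale1r big1 ?addr0 // => b nba.
by rewrite eq_sym (negbTE nba) scale0r.
Qed.

Lemma W_basicP w : W_basic f w <-> exists2 p, Sg_inv f p & w = sp_mono p set0.
Proof.
split=> [bw|[p /Sg_invP ip ->] a].
  have ew := W_basic_mono (fun a => (bw a).1); exists (w set0) => //.
  apply/Sg_invP => a; have := (bw a).2; rewrite ew W_L_mono -ew.
  by move/ffunP/(_ set0); rewrite !ffunE eqxx.
by rewrite W_iota_mono W_L_mono ip sp_mono0.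
Qed.

(** * The differentials *)

(** On polynomials in v, d = theta^b L_b: by dv^a = - f_abc theta^b v^c and
    antisymmetry of f.  So the basic complex of W has zero differential. *)
Lemma W_d_basic w : W_basic f w -> W_d f w = 0.
Proof.
move=> bw; have ew := W_basic_mono (fun a => (bw a).1).
have Lw b : W_L f b w = \sum_a (\sum_c f b a c *: ev c) * sp_deven a w.
  by rewrite /W_L /sder [X in _ + X]big1 ?addr0 // => c _; rewrite ew sp_doddC mulr0.
rewrite /W_d /sder [X in _ + X]big1 ?addr0 => [|b _]; last by rewrite ew sp_doddC mulr0.
transitivity (\sum_b od n b * W_L f b w); last first.
  by apply: big1 => b _; rewrite (bw b).2 mulr0.
under [RHS]eq_bigr => b _ do rewrite Lw mulr_sumr.
rewrite exchange_big /=; apply: eq_bigr => a _.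
under [RHS]eq_bigr => b _ do rewrite mulrA.
rewrite -mulr_suml -sumrN; congr (_ * _); apply: eq_bigr => b _.
rewrite mulr_sumr -sumrN; apply: eq_bigr => c _.
by rewrite [f b a c]fC scaleNr mulrN scalerAr.
Qed.

Lemma W_basic0 : W_basic f 0.
Proof. by move=> a; rewrite /W_iota /W_L !linear0. Qed.

Lemma WK_d_even b : WK_d (ev b) = 0 :> superpoly R n n.
Proof. exact: sder_even. Qed.

Lemma WK_d_odd b : WK_d (od n b) = ev b :> superpoly R n n.
Proof. exact: sder_odd. Qed.

Lemma WK_iota_even a b : WK_iota f a (ev b) = \sum_c f a b c *: od n c.
Proof. exact: sder_even. Qed.

Lemma WK_iota_odd a b : WK_iota f a (od n b) = (a == b)%:R *: 1 :> superpoly R n n.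
Proof. by rewrite -sp_nat; exact: sder_odd. Qed.

Lemma WK_dd (w : weil R n) : WK_d (WK_d w) = 0.
Proof.
suff dd : WK_d (WK_d w) + WK_d (WK_d w) = 0.
  apply/eqP; move/eqP: dd; rewrite -mulr2n -scaler_nat scaler_eq0 pnatr_eq0.
  by [].
apply: (@superder_anticommutator R n n (@WK_d R n) (@WK_d R n) (fun=> 0)).
- exact: WK_d_superder.
- exact: WK_d_superder.
- by split=> [a x y|x y]; rewrite ?scaler0 ?mul0r ?mulr0 addr0.
- by move=> b; rewrite WK_d_even; exact: parity0.
- by move=> b; rewrite WK_d_odd; exact: parity_sp_even.
- by move=> b; rewrite WK_d_even; exact: parity0.
- by move=> b; rewrite WK_d_odd; exact: parity_sp_even.
- by move=> b; rewrite WK_d_even (superder0 WK_d_superder) addr0.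
- by move=> b; rewrite WK_d_odd WK_d_even addr0.
Qed.

Lemma WK_cartan a w : WK_d (WK_iota f a w) + WK_iota f a (WK_d w) = WK_L f a w.
Proof.
apply: (@superder_anticommutator R n n (@WK_d R n) (WK_iota f a) (WK_L f a)).
- exact: WK_d_superder.
- exact: WK_iota_superder.
- exact: W_L_superder.
- by move=> b; rewrite WK_d_even; exact: parity0.
- by move=> b; rewrite WK_d_odd; exact: parity_sp_even.
- by move=> b; rewrite WK_iota_even; exact: parity_sum_odd.
- by move=> b; rewrite WK_iota_odd; apply/parityZ/parity1.
- move=> b; rewrite WK_d_even (superder0 (WK_iota_superder a)) addr0 WK_iota_even [RHS]W_L_even.
  rewrite (superder_sum WK_d_superder); apply: eq_bigr => c _.
  by rewrite (superderZ WK_d_superder) WK_d_odd.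
- move=> b; rewrite WK_d_odd WK_iota_odd (superderZ WK_d_superder) (superder1 WK_d_superder).
  by rewrite scaler0 add0r WK_iota_even [RHS]W_L_odd.
Qed.

(** Cartan's formula gives iota_a d w = 0, and then L_a d w = 0 by d d = 0. *)
Lemma WK_d_basic w : WK_basic f w -> WK_basic f (WK_d w).
Proof.
move=> bw a; have [iw Lw] := bw a.
have idw : WK_iota f a (WK_d w) = 0.
  by have := WK_cartan a w; rewrite iw Lw (superder0 WK_d_superder) add0r.
split=> //; rewrite -WK_cartan idw WK_dd.
by rewrite (superder0 WK_d_superder) (superder0 (WK_iota_superder a)) addr0.
Qed.

(** * The isomorphisms *)

Lemma iso_mod_lrmorphism (A B : algType R) (phi : {lrmorphism A -> B})
    (P : A -> Prop) (J : A -> A -> Prop) (Q : B -> Prop) (s : B -> A) :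
    (forall x, P x -> Q (phi x)) -> (forall w, Q w -> P (s w)) ->
    (forall w, Q w -> phi (s w) = w) ->
    (forall x y, P x -> P y -> (phi x = phi y <-> J x y)) ->
  iso_mod phi P J Q.
Proof.
move=> PQ QP sK phiJ; split=> //.
- by split=> [|x y _ _]; rewrite ?rmorph1 ?rmorphM.
- by move=> k x y _ _; rewrite linearP.
- by move=> w Qw; exists (s w); [exact: QP | exact: sK].
Qed.

Lemma sigma0_eqP (p q : STg R n) : sigma0 f p = sigma0 f q <-> set_c1 p = set_c1 q.
Proof. by rewrite /sigma0; split=> [epq|->//]; exact: (can_inj tau0K epq). Qed.

Lemma STg_c1_inv_basic p : STg_c1_inv f p <-> W_basic f (sigma0 f p).
Proof. by split=> [/STg_c1_invP/WK_basicE|/WK_basicE/STg_c1_invP]. Qed.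

Lemma sigma0_inv_iso : iso_mod (sigma0 f) (STg_inv f) (inv_c1_cong f) (W_basic f).
Proof.
apply: (@iso_mod_lrmorphism _ _ (sigma0 f) _ _ _ horizontal_lift).
- by move=> p /STg_inv_c1_inv/STg_c1_inv_basic.
- exact: horizontal_lift_inv.
- by move=> w _; exact: sigma0_horizontal_lift.
- move=> p q ip iq; apply: iff_trans (sigma0_eqP p q) _.
  exact: iff_sym (inv_c1_congP ip iq).
Qed.

Lemma sigma0_c1_inv_iso : iso_mod (sigma0 f) (STg_c1_inv f) (@c1_cong R n) (W_basic f).
Proof.
apply: (@iso_mod_lrmorphism _ _ (sigma0 f) _ _ _ horizontal_lift).
- by move=> p /STg_c1_inv_basic.
- by move=> w bw; apply/STg_inv_c1_inv/horizontal_lift_inv.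
- by move=> w _; exact: sigma0_horizontal_lift.
- move=> p q _ _; apply: iff_trans (sigma0_eqP p q) _.
  exact: iff_sym (c1_congP p q).
Qed.

Lemma set_c1_inv_iso : iso_mod (@set_c1 R n) (STg_inv f) (inv_c1_cong f) (WK_basic f).
Proof.
apply: (@iso_mod_lrmorphism _ _ (@set_c1 R n) _ _ _ (fun w => horizontal_lift (tau0 f w))).
- by move=> p /STg_inv_c1_inv/STg_c1_invP.
- by move=> w /WK_basicE; exact: horizontal_lift_inv.
- exact: set_c1_horizontal_lift.
- by move=> p q ip iq; exact: iff_sym (inv_c1_congP ip iq).
Qed.

(** The coefficient of theta_set0 identifies basic elements with S(g)^g.  It is
    multiplicative on them because they have no other coefficient. *)
Lemma W_basic_iso_Sg (P : STg R n -> Prop) J :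
  iso_mod (sigma0 f) P J (W_basic f) -> iso_mod (fun p => sigma0 f p set0) P J (Sg_inv f).
Proof.
case=> [[phi1 phiM] phiL PQ QP phiJ].
have coef p : P p -> Sg_inv f (sigma0 f p set0) /\ sigma0 f p = sp_mono (sigma0 f p set0) set0.
  by move=> /PQ/W_basicP[q iq ->]; rewrite ffunE eqxx.
split.
- split=> [|p q Pp Pq]; first by rewrite phi1 ffunE eqxx.
  by rewrite phiM // (coef p Pp).2 sp_mono0M [in RHS]ffunE eqxx.
- by move=> k p q Pp Pq; rewrite phiL // spD spZ.
- by move=> p /coef[].
- move=> q iq; have bq : W_basic f (sp_mono q set0) by apply/W_basicP; exists q.
  by have [p Pp ep] := QP _ bq; exists p => //; rewrite ep ffunE eqxx.
- move=> p q Pp Pq; split=> [epq|/(phiJ p q Pp Pq)/(congr1 (fun w : weil R n => w set0)) //].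
  apply/(phiJ p q Pp Pq); rewrite (coef p Pp).2 (coef q Pq).2.
  exact: (congr1 (fun r => sp_mono r set0)).
Qed.

End InvariantsAndBasicElements.

Theorem proposition3p2 (R : realType) (g : vectType R) (G : quadratic_lie g)
    (n : nat) (e : n.-tuple g) (e_orthonormal : orthonormal_basis G e) :
  let f := structure_const G e in
  [/\ (* sigma0 : S(Tg[1]~)^inv <-> (W_g)_basic, with c = 1 *)
      iso_mod (sigma0 f) (STg_inv f) (inv_c1_cong f) (W_basic f),
      (* the same, with the invariants of the quotient S(Tg[1]~) / <c = 1> *)
      iso_mod (sigma0 f) (STg_c1_inv f) (@c1_cong R n) (W_basic f),
      (* the basic complex of W^K, before applying tau0 *)
      iso_mod (@set_c1 R n) (STg_inv f) (inv_c1_cong f) (WK_basic f),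
      (* the basic elements form complexes *)
      (forall w, W_basic f w -> W_basic f (W_d f w)) /\
      (forall w, WK_basic f w -> WK_basic f (@WK_d R n w)) &
      (* S(Tg[1]~)^inv is isomorphic to S(g)^g, with c = 1 *)
      (exists phi : STg R n -> {mpoly R[n]},
        iso_mod phi (STg_inv f) (inv_c1_cong f) (Sg_inv f)) /\
      (exists phi : STg R n -> {mpoly R[n]},
        iso_mod phi (STg_c1_inv f) (@c1_cong R n) (Sg_inv f))].
Proof.
move=> f.
have fC := @structure_constC R g G n e.
have f_cyc := @structure_const_cycle R g G n e.
have f_jacobi := structure_const_jacobi e_orthonormal.
have inv_iso := sigma0_inv_iso fC f_cyc f_jacobi.
have c1_inv_iso := sigma0_c1_inv_iso fC f_cyc f_jacobi.
split; [exact: inv_iso | exact: c1_inv_iso | exact: set_c1_inv_iso | | ].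
  split=> w bw; last exact: WK_d_basic.
  by rewrite W_d_basic //; exact: W_basic0.
by split; eexists; apply: W_basic_iso_Sg; [exact: inv_iso | exact: c1_inv_iso].
Qed.
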